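(* Let $D$ be a real $n\times n$ diagonal matrix with simple spectrum, and let $\mathcal O$ denote either $\mathcal O_D^{\mathbf O}=\{Q^\top D Q : Q\in\mathbf O\}$ or $\mathcal O_D^{\mathbf{GL}}=\{X^{-1}DX : X\in\mathbf{GL}\}$. Let $N=\dim\mathcal O$. Then $\mathcal O$ admits an atlas with charts $\phi^\pi:\mathcal U_D^\pi\subset\mathcal O\to\mathbb R^N$, indexed by the permutations $\pi\in S_n$, with the following properties. 1. Each chart domain $\mathcal U_D^\pi$ is an open dense subset of $\mathcal O$. Each diagonal matrix in $\mathcal O$ belongs to $\mathcal U_D^\pi$ for exactly one $\pi\in S_n$. Each chart $\phi^\pi:\mathcal U_D^\pi\to\mathbb R^N$ is a diffeomorphism (onto $\mathbb R^N$). 2. Each set $\mathcal U_D^\pi$ is invariant under all Toda flows. There is a splitting $N=N_y+N_z$, $\mathbb R^N=\mathbb R^{N_y}\times\mathbb R^{N_z}$, such that in the images of the charts the Toda flow associated with a real polynomial $p$ is $$(\dot y,\dot z)=(0,Cz),\qquad y\in\mathbb R^{N_y},\ z\in\mathbb R^{N_z},$$ for a constant diagonal matrix $C$ (depending on $p$). If $\mathcal O=\mathcal O_D^{\mathbf O}$, then $N_y=0$.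
   Context: All matrices are real $n\times n$. $\mathbf{GL}$ is the group of invertible matrices, $\mathbf O$ the orthogonal group, $S_n$ the symmetric group on $\{1,\dots,n\}$. The sets $\mathcal O_D^{\mathbf O}$ and $\mathcal O_D^{\mathbf{GL}}$ are smooth manifolds (orbits under conjugation by $\mathbf O$ and $\mathbf{GL}$, respectively). Let $\mathcal M$ be the space of real $n\times n$ matrices, $\mathfrak o\subset\mathcal M$ the skew-symmetric matrices and $\mathfrak{up}\subset\mathcal M$ the upper triangular matrices, so that $\mathcal M=\mathfrak o\oplus\mathfrak{up}$; let $\Pi_{\mathfrak o}:\mathcal M\to\mathfrak o$ be the projection associated with this direct sum. For a real polynomial $p$, the Toda flow associated with $p$ is the flow of the differential equation $\dot M=[M,\Pi_{\mathfrak o}\,p(M)]$, $M(0)=M_0$, where $[A,B]=AB-BA$. It preserves $\mathcal O_D^{\mathbf O}$ and $\mathcal O_D^{\mathbf{GL}}$. The charts do not depend on $p$; the matrix $C$ may depend on the chart. *)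

(* Defs.v *)
From HB Require Import structures.
From mathcomp Require Import all_boot all_order all_algebra all_fingroup.
From mathcomp Require Import all_classical all_reals all_analysis.

Set Implicit Arguments.
Unset Strict Implicit.
Unset Printing Implicit Defensive.

Import Order.TTheory GRing.Theory Num.Theory.
Import numFieldNormedType.Exports.

Local Open Scope classical_set_scope.
Local Open Scope ring_scope.

Section Smoothness.
Context {R : realType}.

(* In finite dimension, and for U open, Ck_on k U f says that f is of class
   C^k on U. *)
Fixpoint Ck_on {V W : normedModType R} (k : nat) (U : set V) (f : V -> W)
    : Prop :=
  match k with
  | 0%N => forall x, U x -> {for x, continuous f}
  | k'.+1 => (forall x, U x -> differentiable f x) /\
             (forall v : V, Ck_on k' U (fun x => 'D_v f x))
  end.

(* C^oo on an arbitrary subset S of a Euclidean space: local extendability to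
   C^oo maps on open sets of the ambient space. *)
Definition smooth_on {V W : normedModType R} (S : set V) (f : V -> W) : Prop :=
  forall x, S x -> exists (U : set V) (g : V -> W),
    [/\ open U, U x, forall k, Ck_on k U g
      & forall y, U y -> S y -> f y = g y].

Definition diffeomorphism {V W : normedModType R} (S : set V) (T : set W)
    (f : V -> W) : Prop :=
  [/\ set_bij S T f, smooth_on S f
    & exists2 g : W -> V, smooth_on T g & forall x, S x -> g (f x) = x].

Definition open_in {V : normedModType R} (S U : set V) : Prop :=
  exists2 W : set V, open W & U = S `&` W.

(* For nonempty S the integer N is unique, by invariance of dimension. *)
Definition submanifold_of_dim {V : normedModType R} (N : nat) (S : set V)
    : Prop :=
  forall x, S x -> exists (U : set V) (T : set 'cV[R]_N) (f : V -> 'cV[R]_N),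
    [/\ open_in S U, U x, open T & diffeomorphism U T f].

(* Compatibility of two charts is automatic: both are diffeomorphisms for the
   smooth structure induced by the ambient space V. *)
Definition atlas {V : normedModType R} {I : Type} (N : nat) (S : set V)
    (U : I -> set V) (f : I -> V -> 'cV[R]_N) : Prop :=
  \bigcup_(i in [set: I]) U i = S /\
  forall i, open_in S (U i) /\
    exists2 T : set 'cV[R]_N, open T & diffeomorphism (U i) T (f i).

Definition dense_in {V : normedModType R} (S U : set V) : Prop :=
  U `<=` S /\ S `<=` closure U.

Definition open_interval (J : set R) : Prop := open J /\ is_interval J.

Definition integral_curve {V : normedModType R} (X : V -> V) (J : set R)
    (c : R -> V) : Prop :=
  forall t : R, J t -> is_derive t (1 : R) c (X (c t)).

End Smoothness.

Section Orbits.
Context {R : realType} {n : nat}.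
Implicit Types (A D M : 'M[R]_n.+1) (p : {poly R}).

Definition simple_spectrum D : Prop :=
  forall a : R, eigenvalue D a -> mup a (char_poly D) = 1%N.

Definition orthogonal_orbit D : set 'M[R]_n.+1 :=
  [set M | exists2 Q : 'M[R]_n.+1, Q^T *m Q = 1%:M & M = Q^T *m D *m Q].

Definition GL_orbit D : set 'M[R]_n.+1 :=
  [set M | exists2 X : 'M[R]_n.+1, X \in unitmx & M = invmx X *m D *m X].

Definition skew A : Prop := A^T = - A.

(* is_trig_mx is lower triangularity. *)
Definition upper_triangular A : Prop := is_trig_mx A^T.

(* The projection onto the skew-symmetric matrices along the upper triangular
   ones; see proj_skew_decomp and proj_skew_unique. *)
Definition proj_skew A : 'M[R]_n.+1 :=
  \matrix_(i, j) (if (j < i)%N then A i j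
                  else if (i < j)%N then - A j i else 0).

Lemma proj_skew_decomp A :
  skew (proj_skew A) /\ upper_triangular (A - proj_skew A).
Proof.
split.
  apply/matrixP => i j; rewrite !mxE.
  by case: ltngtP => _; rewrite ?opprK ?oppr0.
by apply/is_trig_mxP => i j ij; rewrite !mxE ij subrr.
Qed.

Lemma proj_skew_unique A (K B : 'M[R]_n.+1) :
  skew K -> upper_triangular B -> A = K + B -> proj_skew A = K.
Proof.
move=> Ksk /is_trig_mxP Bup ->; apply/matrixP => i j.
have KE k l : K k l = - K l k by have /matrixP/(_ l k) := Ksk; rewrite !mxE.
have B0 (k l : 'I_n.+1) : (l < k)%N -> B k l = 0 by move=> /(Bup l k); rewrite mxE.
rewrite !mxE; case: ltngtP => [ji|ij|/val_inj ->].
- by rewrite B0 // addr0.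
- by rewrite B0 // addr0 -KE.
- have /eqP := KE i i; rewrite -addr_eq0 -mulr2n mulrn_eq0 /=.
  by move=> /eqP ->.
Qed.

Definition toda_field p M : 'M[R]_n.+1 :=
  let K := proj_skew (horner_mx M p) in M *m K - K *m M.

End Orbits.

Section LinearField.
Context {R : realType} {Ny Nz : nat}.

(* A point of R^Ny x R^Nz is the column col_mx y z. *)
Definition linear_field (C : 'M[R]_Nz) (w : 'cV[R]_(Ny + Nz))
    : 'cV[R]_(Ny + Nz) :=
  col_mx 0 (C *m dsubmx w).

End LinearField.

(* Main.v *)
(* Fix an ordering e of the spectrum. A matrix M with simple spectrum e is
   X^-1 diag(e) X, where X is unique up to a diagonal factor on the left; the
   chart domain of the ordering consists of the M whose X has an LU
   factorization. Normalize X so that X = L W = T^-1 Q with L, T lower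
   unipotent, W upper triangular with positive diagonal and Q orthogonal: then
   (T, L) are coordinates, and T = 1 exactly when M is symmetric. Conversely
   W^-1 is the Cholesky factor of (T L)^T (T L), so everything is smooth.
   Conjugating L by exp (t p(diag e)) and keeping T moves M along the Toda flow
   of p, by the usual QR argument, and this is linear and diagonal in L. The
   statements on arbitrary integral curves follow by uniqueness of solutions of
   ordinary differential equations. *)
Require Import Defs.
From HB Require Import structures.
From mathcomp Require Import all_boot all_order all_algebra all_fingroup.
From mathcomp Require Import all_classical all_reals all_analysis.
From mathcomp Require Import ring.
Import Order.TTheory GRing.Theory Num.Theory.
Import numFieldNormedType.Exports.
Local Open Scope classical_set_scope.
Local Open Scope ring_scope.

Set Implicit Arguments.
Unset Strict Implicit.
Unset Printing Implicit Defensive.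

(** Smoothness on an orbit asks for extensions to open sets of matrices, where the spectrum need no
    longer be [e], so a chart needs an eigenvector matrix that is a function of an arbitrary matrix.
    It is taken polynomial in [M], from products of the factors [M - e_j], which on the orbit are
    multiples of the spectral projectors. All other maps are built from ring operations, inverses of
    nonzero quantities and square roots of positive ones, Gaussian elimination giving both the LU
    and the Cholesky factor; no inverse function theorem enters.

    The charts are defined backwards, as inverses of an injective parametrization of R^N, so
    surjectivity is free. The orthogonal orbit is the symmetric part of the other one; a boolean
    switches off the [T] coordinates and both cases share one proof.

    The explicit curves in a chart exist for all times. Hence uniqueness of solutions gives at once
    the invariance of the domains and the linear form of the flow.

    Density needs perturbations that stay in the orbit and keep symmetry, whence conjugation by
    orthogonal matrices close to 1. *)

Section SmoothCalculus.

(** * Calculus of C^k maps: ring operations, inverse, square root, matrix entries *)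

Context {R : realType}.

Lemma near_eq_differentiable (V W : normedModType R) (f g : V -> W) (x : V) :
  (\near x, f x = g x) -> differentiable f x -> differentiable g x.
Proof.
move=> fg df; have [dfc fE] := (diff_locallyP x f).1 df.
have E : g \o shift x = cst (g x) + 'd f x +o_ 0 id.
  apply/eqaddoP => _ /posnumP[e].
  have /eqaddoP/(_ _ (gt0 e)) := fE.
  have nb : \forall h \near (0 : V), f (h + x) = g (h + x).
    rewrite (near_shift x) /=; near=> y.
    by rewrite /= sub0r addrNK; near: y.
  move=> fo; near=> h.
  have fgx : f x = g x by exact: nbhs_singleton fg.
  have -> : (g \o shift x - (cst (g x) + 'd f x)) h =
            (f \o shift x - (cst (f x) + 'd f x)) h.
    have := near nb h; rewrite /shift /= => Eh.
    by rewrite !fctE /= fgx -Eh.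
  by near: h.
apply/diff_locallyP; have -> : 'd g x = 'd f x :> (V -> W).
  exact: diff_unique.
by split.
Unshelve. all: by end_near. Qed.

(** [Ck_on] recurses on [fun x => 'D_v f x] as a function on all of [V], while the rules of calculus
    give that derivative only at points of [U]. This lemma swaps one for the other; openness turns
    agreement on [U] into agreement near each of its points. *)
Lemma Ck_ext (V W : normedModType R) k (U : set V) (f g : V -> W) : open U ->
  (forall x, U x -> f x = g x) -> Ck_on k U f -> Ck_on k U g.
Proof.
move=> oU; elim: k f g => [|k IH] f g fg.
  move=> cf x Ux; have nfg : \near x, f x = g x.
    by apply: filterS (open_nbhs_nbhs (conj oU Ux)) => y; exact: fg.
  suff : g @ x --> g x by [].
  by rewrite -(fg x Ux); exact: cvg_trans (near_eq_cvg nfg) (cf x Ux).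
have nfg x : U x -> \near x, f x = g x.
  by move=> Ux; apply: filterS (open_nbhs_nbhs (conj oU Ux)) => y; exact: fg.
move=> [df Df]; split=> [x Ux|v].
  exact: near_eq_differentiable (nfg x Ux) (df x Ux).
apply: IH (Df v) => x Ux; exact: near_eq_derive (nfg x Ux).
Qed.

Lemma CkW (V W : normedModType R) k (U : set V) (f : V -> W) :
  Ck_on k.+1 U f -> Ck_on k U f.
Proof.
elim: k f => [|k IH] f; first by move=> [df _] x /df/differentiable_continuous.
by move=> [df Df]; split=> // v; exact: IH (Df v).
Qed.

Lemma Ck_sub (V W : normedModType R) k (U U' : set V) (f : V -> W) :
  U' `<=` U -> Ck_on k U f -> Ck_on k U' f.
Proof.
move=> sU; elim: k f => [|k IH] f /=; first by move=> cf x /sU; exact: cf.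
by move=> [df Df]; split=> [x /sU|v]; [exact: df|exact/IH/Df].
Qed.

Lemma Ck_cst (V W : normedModType R) k (U : set V) (a : W) :
  Ck_on k U (fun=> a).
Proof.
elim: k a => [|k IH] a; first by move=> x _; exact: cst_continuous.
split=> [x _|v]; first exact: differentiable_cst.
by under [X in Ck_on _ _ X]eq_fun do rewrite derive_cst.
Qed.

Lemma CkD (V W : normedModType R) k (U : set V) (f g : V -> W) : open U ->
  Ck_on k U f -> Ck_on k U g -> Ck_on k U (fun x => f x + g x).
Proof.
move=> oU; elim: k f g => [|k IH] f g /=.
  by move=> cf cg x Ux; apply: continuousD; [exact: cf|exact: cg].
move=> [df Df] [dg Dg]; split=> [x Ux|v].
  by apply: differentiableD; [exact: df|exact: dg].
apply: Ck_ext (IH _ _ (Df v) (Dg v)) => // x Ux /=.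
by rewrite deriveD //; apply: diff_derivable; [exact: df|exact: dg].
Qed.

Lemma CkM (V : normedModType R) k (U : set V) (f g : V -> R) : open U ->
  Ck_on k U f -> Ck_on k U g -> Ck_on k U (fun x => f x * g x).
Proof.
move=> oU; elim: k f g => [|k IH] f g.
  by move=> cf cg x Ux; apply: continuousM; [exact: cf|exact: cg].
move=> Cf Cg; have [df Df] := Cf; have [dg Dg] := Cg; split=> [x Ux|v].
  by apply: differentiableM; [exact: df|exact: dg].
apply: Ck_ext (CkD oU (IH _ _ (CkW Cf) (Dg v)) (IH _ _ (CkW Cg) (Df v))) => //.
move=> x Ux; rewrite [RHS]deriveM //; apply: diff_derivable;
  [exact: df|exact: dg].
Qed.

(** A bootstrap: the derivative of [1 / f] is a polynomial in [1 / f] and ['D_v f], and the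
    induction hypothesis covers [1 / f] itself at one order less. [Ck_sqrt] follows the same
    pattern. *)
Lemma CkV (V : normedModType R) k (U : set V) (f : V -> R) : open U ->
  (forall x, U x -> f x != 0) -> Ck_on k U f -> Ck_on k U (fun x => (f x)^-1).
Proof.
move=> oU f0; elim: k => [|k IH].
  by move=> cf x Ux; apply: continuousV; [exact: f0|exact: cf].
move=> Cf; have [df Df] := Cf; split=> [x Ux|v].
  by apply: differentiableV; [exact: df|exact: f0].
have CV := IH (CkW Cf).
have C1 := @Ck_cst V R k U (-1).
apply: Ck_ext (CkM oU C1 (CkM oU (CkM oU CV CV) (Df v))) => //.
move=> x Ux; rewrite deriveV ?f0//; last exact: diff_derivable (df x Ux).
by rewrite mulN1r scaleNr -invfM expr2.
Qed.

Lemma derive_sqrt_comp (V : normedModType R) (f : V -> R) (x v : V) :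
  0 < f x -> differentiable f x ->
  differentiable (fun y => Num.sqrt (f y)) x /\
  'D_v (fun y => Num.sqrt (f y)) x = (2 * Num.sqrt (f x))^-1 * 'D_v f x.
Proof.
move=> fx0 df; have ds : differentiable (@Num.sqrt R) (f x).
  by apply/derivable1_diffP; have [] := is_derive1_sqrt fx0.
split; first exact: differentiable_comp df ds.
rewrite deriveE; last exact: differentiable_comp df ds.
have ds1 : derivable (@Num.sqrt R) (f x) 1 by apply/derivable1_diffP.
rewrite (diff_comp df ds) /= (deriveE _ df) (deriv1E ds1) derive1E.
by rewrite (derive_sqrt fx0) [RHS]mulrC.
Qed.

Lemma Ck_sqrt (V : normedModType R) k (U : set V) (f : V -> R) : open U ->
  (forall x, U x -> 0 < f x) -> Ck_on k U f ->
  Ck_on k U (fun x => Num.sqrt (f x)).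
Proof.
move=> oU f0; elim: k => [|k IH].
  move=> cf x Ux; apply: continuous_comp; first exact: cf.
  exact: sqrt_continuous.
move=> Cf; have [df Df] := Cf; split=> [x Ux|v].
  by have [] := derive_sqrt_comp x (f0 x Ux) (df x Ux).
have s0 x : U x -> 2 * Num.sqrt (f x) != 0.
  by move=> Ux; rewrite gt_eqF // mulr_gt0 // sqrtr_gt0 f0.
have CV := CkV oU s0 (CkM oU (@Ck_cst V R k U 2) (IH (CkW Cf))).
apply: Ck_ext (CkM oU CV (Df v)) => // x Ux.
by have [_ ->] := derive_sqrt_comp v (f0 x Ux) (df x Ux).
Qed.

Lemma Ck_linear (V W : normedModType R) k (U : set V) (f : {linear V -> W}) :
  continuous f -> Ck_on k U f.
Proof.
move=> cf; case: k => [|k]; first by move=> x _; exact: cf.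
split=> [x _|v]; first exact: linear_differentiable.
have -> : (fun x => 'D_v f x) = cst (f v); last exact: Ck_cst.
apply/funext => x; rewrite deriveE; last exact: linear_differentiable.
by rewrite diff_lin.
Qed.

Lemma differentiable_mxP (V : normedModType R) m n (f : V -> 'M[R]_(m, n)) x :
  differentiable f x <-> forall i j, differentiable (fun y => f y i j) x.
Proof.
split=> [df i j|df].
  exact: differentiable_comp df (differentiable_coord _ _ _).
have -> : f = \sum_(i < m) \sum_(j < n)
    (fun y => f y i j *: (delta_mx i j : 'M[R]_(m, n))).
  apply/funext => y; rewrite [LHS]matrix_sum_delta fct_sumE.
  by apply: eq_bigr => i _; rewrite fct_sumE.
apply: differentiable_sum => i; apply: differentiable_sum => j.
exact: differentiableZl.
Qed.

Lemma Ck_mxP (V : normedModType R) k (U : set V) m n (f : V -> 'M[R]_(m, n)) :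
  open U -> Ck_on k U f <-> forall i j, Ck_on k U (fun y => f y i j).
Proof.
move=> oU; elim: k f => [|k IH] f.
  split=> [cf i j x Ux|cf x Ux].
    exact: (continuous_comp (cf x Ux) (@coord_continuous R m n i j (f x))).
  have -> : f = \sum_(i < m) \sum_(j < n)
      (fun y => f y i j *: (delta_mx i j : 'M[R]_(m, n))).
    apply/funext => y; rewrite [LHS]matrix_sum_delta fct_sumE.
    by apply: eq_bigr => i _; rewrite fct_sumE.
  elim/big_ind: _ => [|g h cg ch|i _]; first exact: cst_continuous.
    exact: continuousD.
  elim/big_ind: _ => [|g h cg ch|j _]; first exact: cst_continuous.
    exact: continuousD.
  by apply: continuousZr_tmp; exact: cf.
have E (df : forall x, U x -> differentiable f x) v i j x : U x ->
    ('D_v f x) i j = 'D_v (fun y => f y i j) x.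
  by move=> /df/diff_derivable dfx; rewrite derive_mx // mxE.
split=> [[df Df] i j|Cf]; first split=> [x Ux|v].
- exact: (differentiable_mxP f x).1 (df x Ux) i j.
- apply: Ck_ext ((IH _).1 (Df v) i j) => // x Ux; exact: E.
- have df x : U x -> differentiable f x.
    by move=> Ux; apply/differentiable_mxP => i j; have [+ _] := Cf i j; apply.
  split=> // v; apply/IH => i j.
  have [_ /(_ v)] := Cf i j; apply: Ck_ext => // x Ux; exact/esym/E.
Qed.

End SmoothCalculus.

(** * Triangular matrices and uniqueness of LU factorizations *)

Section Triangular.
Context {F : fieldType}.

Lemma trig0 n (A : 'M[F]_n) : is_trig_mx A ->
  forall i j : 'I_n, (i < j)%N -> A i j = 0.
Proof. by move=> /is_trig_mxP. Qed.

Lemma trig_mulmx n (A B : 'M[F]_n) :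
  is_trig_mx A -> is_trig_mx B -> is_trig_mx (A *m B).
Proof.
move=> /is_trig_mxP tA /is_trig_mxP tB; apply/is_trig_mxP => i j ij.
rewrite mxE big1 // => k _; have [ik|ki] := ltnP i k; first by rewrite tA ?mul0r.
by rewrite tB ?mulr0 // (leq_ltn_trans ki).
Qed.

Lemma trig_mulmx_diag n (A B : 'M[F]_n) i :
  is_trig_mx A -> is_trig_mx B -> (A *m B) i i = A i i * B i i.
Proof.
move=> /is_trig_mxP tA /is_trig_mxP tB; rewrite mxE (bigD1 i) //= big1 ?addr0 //.
move=> k; rewrite neq_ltn => /orP[ki|ik]; first by rewrite tB ?mulr0.
by rewrite tA ?mul0r.
Qed.

Lemma trig_unitmx n (A : 'M[F]_n) : is_trig_mx A ->
  (A \in unitmx) = [forall i, A i i != 0].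
Proof.
move=> tA; rewrite unitmxE det_trig // unitfE.
by apply/prodf_neq0/forallP => H i; move: (H i) => //; exact.
Qed.

Lemma trig_invmx n (A : 'M[F]_n) : is_trig_mx A -> A \in unitmx ->
  is_trig_mx (invmx A).
Proof.
move=> tA uA; apply/is_trig_mxP => i.
have A0 k : A k k != 0 by move: uA; rewrite trig_unitmx // => /forallP.
(* Strong induction on the row: in row [i] of [A *m invmx A = 1] the terms with [k < i] vanish by
   induction, those with [k > i] by triangularity of [A]. *)
have [m] := ubnP i; elim: m i => // m IH i im j ij.
have /matrixP/(_ i j) := mulmxV uA; rewrite !mxE (bigD1 i) //= big1 ?addr0.
  rewrite -val_eqE (ltn_eqF ij) => /eqP.
  by rewrite mulf_eq0 (negPf (A0 i)) => /eqP.
move=> k; rewrite neq_ltn => /orP[ki|ik].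
  by rewrite IH ?mulr0 //; [exact: leq_trans ki _|exact: ltn_trans ij].
by rewrite (trig0 tA) ?mul0r.
Qed.

Lemma trig_invmx_diag n (A : 'M[F]_n) i : is_trig_mx A -> A \in unitmx ->
  invmx A i i = (A i i)^-1.
Proof.
move=> tA uA; have A0 : A i i != 0.
  by move: uA; rewrite trig_unitmx // => /forallP/(_ i).
apply: (mulfI A0); rewrite -trig_mulmx_diag ?trig_invmx // mulmxV // mxE eqxx.
by rewrite mulfV.
Qed.

Definition unil n (L : 'M[F]_n) := is_trig_mx L /\ forall i, L i i = 1.

Definition upu n (U : 'M[F]_n) := is_trig_mx U^T /\ forall i, U i i != 0.

Lemma unil_unit n (L : 'M[F]_n) : unil L -> L \in unitmx.
Proof.
by move=> [tL L1]; rewrite trig_unitmx //; apply/forallP => i; rewrite L1 oner_neq0.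
Qed.

Lemma unil1 n : unil (1%:M : 'M[F]_n).
Proof. by split=> [|i]; [exact: scalar_mx_is_trig|rewrite mxE eqxx]. Qed.

Lemma unilM n (A B : 'M[F]_n) : unil A -> unil B -> unil (A *m B).
Proof.
move=> [tA A1] [tB B1]; split=> [|i]; first exact: trig_mulmx.
by rewrite trig_mulmx_diag // A1 B1 mulr1.
Qed.

Lemma unilV n (A : 'M[F]_n) : unil A -> unil (invmx A).
Proof.
move=> uA; have [tA A1] := uA; have uuA := unil_unit uA.
by split=> [|i]; [exact: trig_invmx|rewrite trig_invmx_diag // A1 invr1].
Qed.

Lemma upu_unit n (U : 'M[F]_n) : upu U -> U \in unitmx.
Proof.
move=> [tU U0]; rewrite -unitmx_tr trig_unitmx //.
by apply/forallP => i; rewrite mxE.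
Qed.

Lemma upu_diag n (A B : 'M[F]_n) i : is_trig_mx A^T -> is_trig_mx B^T ->
  (A *m B) i i = A i i * B i i.
Proof.
move=> tA tB; have := trig_mulmx_diag i tB tA.
by rewrite -trmx_mul mxE => ->; rewrite !mxE mulrC.
Qed.

Lemma upper_mulmx n (A B : 'M[F]_n) : is_trig_mx A^T -> is_trig_mx B^T ->
  is_trig_mx (A *m B)^T.
Proof. by move=> tA tB; rewrite trmx_mul trig_mulmx. Qed.

Lemma upuM n (A B : 'M[F]_n) : upu A -> upu B -> upu (A *m B).
Proof.
move=> [tA A0] [tB B0]; split=> [|i]; first exact: upper_mulmx.
by rewrite upu_diag // mulf_neq0.
Qed.

Lemma upuV n (U : 'M[F]_n) : upu U -> upu (invmx U).
Proof.
move=> uU; have [tU U0] := uU; have uuU := upu_unit uU.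
rewrite /upu trmx_inv; split=> [|i]; first by rewrite trig_invmx ?unitmx_tr.
have -> : invmx U i i = (invmx U^T) i i by rewrite -trmx_inv mxE.
by rewrite trig_invmx_diag ?unitmx_tr // mxE invr_neq0.
Qed.

Lemma upuV_diag n (U : 'M[F]_n) i : upu U -> invmx U i i = (U i i)^-1.
Proof.
move=> uU; have [tU U0] := uU; have uuU := upu_unit uU.
have -> : invmx U i i = (invmx U^T) i i by rewrite -trmx_inv mxE.
by rewrite trig_invmx_diag ?unitmx_tr // mxE.
Qed.

(** [L'^-1 L = U' U^-1] is unipotent lower triangular and upper triangular at once, hence 1. *)
Lemma lu_unique n (L L' U U' : 'M[F]_n) : unil L -> unil L' -> upu U -> upu U' ->
  L *m U = L' *m U' -> L = L' /\ U = U'.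
Proof.
move=> uL uL' uU uU' E; have [vL vL'] := (unil_unit uL, unil_unit uL').
have [vU vU'] := (upu_unit uU, upu_unit uU').
have E1 : invmx L' *m L = U' *m invmx U.
  by apply: (canRL (mulmxK vU)); rewrite -mulmxA E mulKmx.
have [tl l1] := unilM (unilV uL') uL.
have [tu _] := upuM uU' (upuV uU).
have E2 : invmx L' *m L = 1%:M.
  apply/matrixP => i j; have [ij|ji|/val_inj ->] := ltngtP i j.
  - by rewrite (trig0 tl) // mxE -val_eqE (ltn_eqF ij).
  - move/is_trig_mxP : tu => /(_ _ _ ji); rewrite mxE E1 => ->.
    by rewrite mxE -val_eqE (gtn_eqF ji).
  - by rewrite l1 mxE eqxx.
have EL : L = L' by rewrite -(mulKVmx vL' L) E2 mulmx1.
by split=> //; apply: (can_inj (mulKmx vL)); rewrite E EL.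
Qed.

End Triangular.

(** * Gaussian elimination without pivoting *)

Section LU.

(* [a d - c b] is the Schur complement scaled by the pivot: it is polynomial in
   the entries, which lets [piv] commute with ring morphisms. *)
Definition schur {R : comNzRingType} n (A : 'M[R]_n.+1) : 'M[R]_n :=
  \matrix_(i, j) (A 0 0 * A (lift 0 i) (lift 0 j) - A (lift 0 i) 0 * A 0 (lift 0 j)).

(** A product of positive powers of the leading principal minors. A single polynomial thus decides
    whether an LU factorization exists, which makes the condition open and testable along a
    polynomial path. *)
Fixpoint piv {R : comNzRingType} n : 'M[R]_n -> R :=
  match n with
  | 0 => fun=> 1
  | n'.+1 => fun A => A 0 0 * piv (schur A)
  end.

(** Meant for evaluation of polynomials: along a polynomial path of matrices [piv] is a polynomial
    in the time, so it has finitely many zeros unless it is 0. *)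
Lemma piv_map (R S : comNzRingType) (f : {rmorphism R -> S}) n (A : 'M[R]_n) :
  piv (map_mx f A) = f (piv A).
Proof.
elim: n A => [|n IH] A /=; first by rewrite rmorph1.
rewrite rmorphM -IH mxE; congr (_ * piv _).
by apply/matrixP => i j; rewrite !mxE rmorphB !rmorphM.
Qed.

Context {F : fieldType}.

(** The scaling in [schur] does not affect the lower factor. Over a zero pivot the division gives 0,
    so the result is unipotent for every [A]. *)
Fixpoint luL n : 'M[F]_n -> 'M[F]_n :=
  match n with
  | 0 => id
  | n'.+1 => fun A => \matrix_(i, j)
      match unlift 0 i, unlift 0 j with
      | Some i', Some j' => luL (schur A) i' j'
      | Some _, None => A i 0 / A 0 0
      | None, _ => (j == 0)%:R
      end
  end.

Lemma luL_unil n (A : 'M[F]_n) : unil (luL A).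
Proof.
elim: n A => [|n IH] A /=; first by split=> [|[]//]; apply/is_trig_mxP => -[].
have [/is_trig_mxP tL L1] := IH (schur A).
split=> [|i]; first apply/is_trig_mxP => i j.
  rewrite mxE; case: (unliftP 0 i) => [i' ->|->]; case: (unliftP 0 j) => [j' ->|->] //= ij.
  by apply: tL; rewrite -ltnS.
rewrite mxE; case: unliftP => [i' _|->]; [exact: L1|by rewrite eqxx].
Qed.

Lemma lu_exists n (A : 'M[F]_n) : piv A != 0 ->
  exists2 U, upu U & A = luL A *m U.
Proof.
elim: n A => [|n IH] A /=.
  by move=> _; exists 1%:M; [split=> [|[]//]; apply/is_trig_mxP => -[]
                            |apply/matrixP => -[]].
rewrite mulf_eq0 negb_or => /andP[a0 /IH[U [/is_trig_mxP tU U0] SU]].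
(* The rows below the first are divided by [A 0 0] to undo the scaling in [schur]. *)
exists (\matrix_(i, j) match unlift 0 i, unlift 0 j with
      | Some i', Some j' => U i' j' / A 0 0
      | Some _, None => 0
      | None, _ => A 0 j
      end).
  split=> [|i]; first apply/is_trig_mxP => i j.
    rewrite !mxE; case: (unliftP 0 i) => [i' ->|->]; case: (unliftP 0 j) => [j' ->|->] //= ij.
    by have := tU i' j'; rewrite !mxE => -> //; rewrite mul0r.
  by rewrite mxE; case: unliftP => [i' _|-> //]; rewrite mulf_neq0 // invr_eq0.
apply/matrixP => i j; rewrite mxE big_ord_recl !mxE unlift_none.
case: (unliftP 0 i) => [i' ->|->]; last first.
  rewrite eqxx mul1r big1 ?addr0 // => k _.
  by rewrite !mxE unlift_none -val_eqE /= mul0r.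
case: (unliftP 0 j) => [j' ->|->]; last first.
  rewrite mulfVK // big1 ?addr0 // => k _.
  by rewrite !mxE !liftK unlift_none mulr0.
under eq_bigr => k _ do rewrite !mxE !liftK mulrA.
have /matrixP/(_ i' j') := SU; rewrite !mxE => E.
rewrite -mulr_suml -E; apply: (mulIf a0); rewrite mulrDl mulfVK //.
by rewrite mulrAC mulfVK // addrCA subrr addr0 mulrC.
Qed.

(** The diagonal of [L] is only required to be nonzero, for the sake of the induction: the Schur
    complement of [L U] is [c = L 0 0 * U 0 0] times the product of the trailing blocks, and [c] is
    absorbed into [L]. *)
Lemma piv_lu n (L U : 'M[F]_n) :
  is_trig_mx L -> (forall i, L i i != 0) -> upu U -> piv (L *m U) != 0.
Proof.
elim: n L U => [|n IH] L U /=; first by rewrite oner_neq0.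
move=> /is_trig_mxP tL L0 [/is_trig_mxP tU U0].
have E0 j : (L *m U) 0 j = L 0 0 * U 0 j.
  by rewrite mxE big_ord_recl big1 ?addr0 // => k _; rewrite tL ?mul0r.
have E1 i : (L *m U) i 0 = L i 0 * U 0 0.
  rewrite mxE big_ord_recl big1 ?addr0 // => k _.
  by have := tU 0 (lift 0 k); rewrite !mxE => ->; rewrite ?mulr0.
rewrite E0 !mulf_neq0 ?L0 ?U0 //.
set c := L 0 0 * U 0 0.
have c0 : c != 0 by rewrite mulf_neq0.
have -> : schur (L *m U) = (c *: \matrix_(i, j) L (lift 0 i) (lift 0 j)) *m
    (\matrix_(i, j) U (lift 0 i) (lift 0 j)).
  apply/matrixP => i j; rewrite mxE !E0 E1 -/c mxE big_ord_recl.
  rewrite [RHS]mxE; under [in RHS]eq_bigr => k _ do rewrite !mxE -mulrA.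
  by rewrite -mulr_sumr /c; ring.
apply: IH; first apply/is_trig_mxP => i j ij.
- by rewrite !mxE tL ?mulr0.
- by move=> i; rewrite !mxE mulf_neq0.
- split=> [|i]; last by rewrite mxE.
  by apply/is_trig_mxP => i j ij; have := tU (lift 0 i) (lift 0 j); rewrite !mxE => ->.
Qed.

Lemma luL_eq n (L U : 'M[F]_n) : unil L -> upu U -> luL (L *m U) = L.
Proof.
move=> uL uU; have : piv (L *m U) != 0.
  by have [tL L1] := uL; apply: piv_lu => // i; rewrite L1 oner_neq0.
move=> /lu_exists[U' uU' E].
by case: (lu_unique uL (luL_unil _) uU uU' E) => /esym.
Qed.

Lemma luU_upu n (A : 'M[F]_n) : piv A != 0 -> upu (invmx (luL A) *m A).
Proof.
move=> /lu_exists[U uU E]; suff -> : invmx (luL A) *m A = U by [].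
by rewrite {2}E mulKmx // unil_unit //; exact: luL_unil.
Qed.

End LU.

(** * Positive definite matrices and the Cholesky factor *)

Section Cholesky.
Context {R : realType}.

Lemma diag_mxii n (d : 'rV[R]_n) i : diag_mx d i i = d 0 i.
Proof. by rewrite mxE eqxx. Qed.

Lemma sumsq_gt0 n (v : 'cV[R]_n) : v != 0 -> 0 < (v^T *m v) 0 0.
Proof.
move=> v0; rewrite lt0r; apply/andP; split; last first.
  by rewrite mxE sumr_ge0 // => i _; rewrite mxE -expr2 sqr_ge0.
apply: contra v0; rewrite mxE psumr_eq0 => [/allP H|i _]; last first.
  by rewrite mxE -expr2 sqr_ge0.
apply/eqP/colP => i; apply/eqP; rewrite mxE.
by have := H i (mem_index_enum _); rewrite /= mxE -expr2 sqrf_eq0.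
Qed.

Definition posdef n (A : 'M[R]_n) :=
  A^T = A /\ forall x : 'cV[R]_n, x != 0 -> 0 < (x^T *m A *m x) 0 0.

Lemma posdef_gram n (G : 'M[R]_n) : G \in unitmx -> posdef (G^T *m G).
Proof.
move=> uG; split=> [|x x0]; first by rewrite trmx_mul trmxK.
rewrite mulmxA -mulmxA -trmx_mul; apply: sumsq_gt0.
by apply: contra x0 => /eqP Gx; rewrite -(mulKmx uG x) Gx mulmx0.
Qed.

Lemma quad_formE n (A : 'M[R]_n) (x : 'cV[R]_n) :
  (x^T *m A *m x) 0 0 = \sum_i \sum_j x i 0 * A i j * x j 0.
Proof.
rewrite mxE exchange_big; apply: eq_bigr => j _; rewrite mxE mulr_suml.
by apply: eq_bigr => i _; rewrite mxE.
Qed.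

Lemma posdef_pivot n (A : 'M[R]_n.+1) : posdef A -> 0 < A 0 0.
Proof.
move=> [_ /(_ (delta_mx 0 0))]; rewrite trmx_delta -rowE -colE !mxE; apply.
by apply/eqP => /colP/(_ 0); rewrite !mxE !eqxx => /eqP; rewrite oner_eq0.
Qed.

Lemma posdef_schur n (A : 'M[R]_n.+1) : posdef A -> posdef (schur A).
Proof.
move=> pA; have a0 := posdef_pivot pA; have [sA qA] := pA.
have s i j : A i j = A j i by rewrite -[in LHS]sA mxE.
split=> [|x x0].
  apply/matrixP => i j; rewrite !mxE (s (lift 0 j) (lift 0 i)) (s (lift 0 j) 0).
  by rewrite (s 0 (lift 0 i)); ring.
(* The vector [y = (- b, A 0 0 * x)] is chosen so that the first entry of [A y] vanishes; then
   [y^T A y] is [A 0 0] times the quadratic form of [schur A] at [x]. *)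
pose b := \sum_k A 0 (lift 0 k) * x k 0.
pose y : 'cV_n.+1 := \col_i if unlift 0 i is Some k then A 0 0 * x k 0 else - b.
have y0 : y != 0.
  apply: contra x0 => /eqP/colP y0; apply/eqP/colP => k.
  have := y0 (lift 0 k); rewrite !mxE liftK => /eqP.
  by rewrite mulf_eq0 (gt_eqF a0) => /eqP.
have yE0 : y 0 0 = - b by rewrite mxE unlift_none.
have yE1 k : y (lift 0 k) 0 = A 0 0 * x k 0 by rewrite mxE liftK.
have := qA y y0; rewrite quad_formE big_ord_recl big_ord_recl yE0.
have -> : \sum_(i < n) - b * A 0 (lift 0 i) * y (lift 0 i) 0 = - (A 0 0 * b ^+ 2).
  have E i : - b * A 0 (lift 0 i) * y (lift 0 i) 0 =
    (- b * A 0 0) * (A 0 (lift 0 i) * x i 0) by rewrite yE1; ring.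
  under eq_bigr => i _ do rewrite E.
  by rewrite -mulr_sumr -/b; ring.
pose q := \sum_i \sum_j x i 0 * A (lift 0 i) (lift 0 j) * x j 0.
have -> : \sum_(i < n) \sum_j y (lift 0 i) 0 * A (lift 0 i) j * y j 0 =
    - (A 0 0 * b ^+ 2) + A 0 0 ^+ 2 * q.
  under eq_bigr => i _ do rewrite big_ord_recl yE0 yE1.
  rewrite big_split /=; congr (_ + _).
    have E i : A 0 0 * x i 0 * A (lift 0 i) 0 * - b =
      (- b * A 0 0) * (A 0 (lift 0 i) * x i 0) by rewrite (s _ 0); ring.
    under eq_bigr => i _ do rewrite E.
    by rewrite -mulr_sumr -/b; ring.
  rewrite mulr_sumr; apply: eq_bigr => i _; rewrite mulr_sumr.
  by apply: eq_bigr => j _; rewrite yE1; ring.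
have -> : (x^T *m schur A *m x) 0 0 = A 0 0 * q - b ^+ 2.
  rewrite quad_formE; under eq_bigr => i _ do under eq_bigr => j _ do
    rewrite mxE mulrBr mulrBl.
  under eq_bigr => i _ do rewrite big_split /=.
  rewrite big_split /=; congr (_ + _).
    rewrite mulr_sumr; apply: eq_bigr => i _; rewrite mulr_sumr.
    by apply: eq_bigr => j _; ring.
  rewrite expr2 {1}/b mulr_suml -sumrN; apply: eq_bigr => i _.
  rewrite /b mulr_sumr -sumrN; apply: eq_bigr => j _.
  by rewrite (s _ 0); ring.
move=> H; rewrite -(pmulr_rgt0 _ a0); move: H; congr (_ < _); ring.
Qed.

Lemma posdef_piv n (A : 'M[R]_n) : posdef A -> piv A != 0.
Proof.
elim: n A => [|n IH] A pA /=; first exact: oner_neq0.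
by rewrite mulf_neq0 ?(gt_eqF (posdef_pivot pA)) // IH //; exact: posdef_schur.
Qed.

(** With [d] the diagonal of [U], transposing [A = L U] gives a second factorization
    [(U^T d^-1) (d L^T)] of the same matrix; uniqueness forces [U = d L^T]. *)
Lemma ldlt n (A : 'M[R]_n) : A^T = A -> piv A != 0 ->
  A = luL A *m diag_mx (\row_i (invmx (luL A) *m A) i i) *m (luL A)^T.
Proof.
move=> sA pA; have uL := luL_unil A; have vL := unil_unit uL.
set L := luL A in uL vL *; set U := invmx L *m A; set d := diag_mx _.
have uU : upu U by exact: luU_upu.
have [[tU U0] [tL L1]] := (uU, uL).
have ud : d \in unitmx.
  rewrite trig_unitmx ?diag_mx_is_trig //.
  by apply/forallP => i; rewrite diag_mxii mxE U0.
have AE : A = L *m U by rewrite mulKVmx.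
have tdV : is_trig_mx (invmx d) by rewrite trig_invmx ?diag_mx_is_trig.
have udL : upu (d *m L^T).
  split=> [|i].
    by apply: upper_mulmx; rewrite ?trmxK ?tr_diag_mx ?diag_mx_is_trig.
  rewrite upu_diag ?trmxK ?tr_diag_mx ?diag_mx_is_trig //.
  by rewrite diag_mxii mxE [(L^T) i i]mxE L1 mulr1 U0.
have uUd : unil (U^T *m invmx d).
  split=> [|i]; first exact: trig_mulmx.
  rewrite trig_mulmx_diag // trig_invmx_diag ?diag_mx_is_trig //.
  by rewrite diag_mxii [X in _ / X]mxE [X in X / _]mxE mulfV.
have E : L *m U = (U^T *m invmx d) *m (d *m L^T).
  by rewrite mulmxA mulmxKV // -trmx_mul -AE.
have [_ EU] := lu_unique uL uUd uU udL E.
by rewrite -mulmxA -EU.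
Qed.

Lemma posdef_diag_gt0 n (A M : 'M[R]_n) i : posdef A -> M \in unitmx ->
  0 < (M *m A *m M^T) i i.
Proof.
move=> [_ qA] uM; pose x : 'cV[R]_n := M^T *m delta_mx i 0.
have := qA x; have -> : (x^T *m A *m x) 0 0 = (M *m A *m M^T) i i.
  rewrite /x trmx_mul trmxK trmx_delta !mulmxA -!(mulmxA (delta_mx 0 i)).
  by move: (M *m A *m M^T) => B; rewrite -colE -rowE !mxE.
apply; apply/eqP => /(congr1 (mulmx (invmx M^T))).
rewrite mulKmx ?unitmx_tr // mulmx0 => /matrixP/(_ i 0).
by rewrite !mxE !eqxx => /eqP; rewrite oner_eq0.
Qed.

(** Multiplying [L^-1 A] on the right by the unipotent upper matrix [L^-T] keeps its diagonal, and
    [L^-1 A L^-T] is congruent to [A]. *)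
Lemma posdef_lu_diag n (A : 'M[R]_n) i : posdef A ->
  0 < (invmx (luL A) *m A) i i.
Proof.
move=> pA; have uL := luL_unil A; have vL := unil_unit uL.
have uV := unilV uL; have [tV V1] := uV.
have [tU _] := luU_upu (posdef_piv pA).
have := posdef_diag_gt0 i pA (unil_unit uV).
by rewrite upu_diag ?trmxK // [X in _ * X]mxE V1 mulr1.
Qed.

(** The upper triangular Cholesky factor, obtained from the LU factorization through [ldlt] so that
    its smoothness reduces to that of [luL] and of the square root. *)
Definition chol n (A : 'M[R]_n) : 'M[R]_n :=
  diag_mx (\row_i Num.sqrt ((invmx (luL A) *m A) i i)) *m (luL A)^T.

Lemma chol_spec n (A : 'M[R]_n) : posdef A ->
  [/\ is_trig_mx (chol A)^T, forall i, 0 < chol A i i & (chol A)^T *m chol A = A].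
Proof.
move=> pA; have [tL L1] := luL_unil A; rewrite /chol; set s := diag_mx _.
have tC : is_trig_mx (s *m (luL A)^T)^T.
  by apply: upper_mulmx; rewrite ?trmxK ?tr_diag_mx ?diag_mx_is_trig.
split=> // [i|].
  rewrite upu_diag ?trmxK ?tr_diag_mx ?diag_mx_is_trig // diag_mxii mxE.
  by rewrite [X in _ * X]mxE L1 mulr1 sqrtr_gt0 posdef_lu_diag.
rewrite [RHS](ldlt (proj1 pA) (posdef_piv pA)) trmx_mul trmxK tr_diag_mx !mulmxA.
congr (_ *m _); rewrite -mulmxA; congr (_ *m _).
rewrite mulmx_diag; congr diag_mx; apply/rowP => i.
rewrite mxE ![(\row_ _ _) 0 i]mxE -expr2 sqr_sqrtr //.
exact/ltW/posdef_lu_diag.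
Qed.

(** With [d] the diagonal of [V], the product [(V^T d^-1) (d V)] is the LU factorization of [V^T V],
    so [chol] reads off [V] from it. *)
Lemma chol_eq n (V : 'M[R]_n) : is_trig_mx V^T -> (forall i, 0 < V i i) ->
  chol (V^T *m V) = V.
Proof.
move=> tV V0; have uV : upu V by split=> // i; rewrite gt_eqF.
pose d := diag_mx (\row_i V i i).
have ud : d \in unitmx.
  rewrite trig_unitmx ?diag_mx_is_trig //.
  by apply/forallP => i; rewrite diag_mxii mxE gt_eqF.
have E : V^T *m V = (V^T *m invmx d) *m (d *m V) by rewrite mulmxA mulmxKV.
have tdV : is_trig_mx (invmx d) by rewrite trig_invmx ?diag_mx_is_trig.
have uL : unil (V^T *m invmx d).
  split=> [|i]; first exact: trig_mulmx.
  rewrite trig_mulmx_diag // trig_invmx_diag ?diag_mx_is_trig //.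
  by rewrite diag_mxii !mxE mulfV // gt_eqF.
have tdT : is_trig_mx d^T by rewrite tr_diag_mx diag_mx_is_trig.
have uU : upu (d *m V).
  split=> [|i]; first exact: upper_mulmx.
  by rewrite upu_diag // diag_mxii mxE mulf_neq0 ?gt_eqF.
rewrite /chol E luL_eq // mulKmx ?unil_unit //.
have -> : \row_i Num.sqrt ((d *m V) i i) = \row_i V i i.
  apply/rowP => i; rewrite mxE upu_diag // diag_mxii !mxE -expr2.
  by rewrite sqrtr_sqr ger0_norm // ltW.
by rewrite trmx_mul trmxK trmx_inv tr_diag_mx -/d mulKVmx.
Qed.

End Cholesky.

(** * Coordinates [(T, L)] for matrices with a fixed ordered spectrum *)

Section Charts.
Context {R : realType} {n : nat}.
Implicit Types (T L X M V W : 'M[R]_n) (e : 'rV[R]_n).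

Definition frame T L := L *m invmx (chol ((T *m L)^T *m (T *m L))).

Definition chart_inv e T L :=
  let X := frame T L in invmx X *m diag_mx e *m X.

Lemma gram_orthogonal (G V : 'M[R]_n) : V \in unitmx -> V^T *m V = G^T *m G ->
  (G *m invmx V)^T *m (G *m invmx V) = 1%:M.
Proof.
move=> vV VE; rewrite trmx_mul -mulmxA (mulmxA G^T) -VE mulmxK //.
by rewrite -trmx_mul mulmxV // trmx1.
Qed.

Lemma orthogonal_gram (G W : 'M[R]_n) : W \in unitmx ->
  (G *m W)^T *m (G *m W) = 1%:M -> (invmx W)^T *m invmx W = G^T *m G.
Proof.
move=> vW QE; rewrite -[X in _ *m X]mul1mx -QE trmx_mul -!mulmxA mulmxV //.
by rewrite mulmx1 !mulmxA -trmx_mul mulmxV // trmx1 mul1mx.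
Qed.

Lemma frame_spec T L : unil T -> unil L ->
  (T *m frame T L)^T *m (T *m frame T L) = 1%:M /\
  exists W, [/\ upu W, forall i, 0 < W i i & frame T L = L *m W].
Proof.
move=> uT uL; set G := T *m L.
have uG : G \in unitmx by rewrite unitmx_mul !unil_unit.
have [tV V0 VE] := chol_spec (posdef_gram uG).
rewrite /frame -/G; set V := chol _ in tV V0 VE *.
have uV : upu V by split=> // i; rewrite gt_eqF.
have vV := upu_unit uV.
split; last first.
  exists (invmx V); split=> //; first exact: upuV.
  by move=> i; rewrite upuV_diag // invr_gt0.
by rewrite (mulmxA T) -/G gram_orthogonal.
Qed.

Lemma frame_eq T L W : unil T -> unil L -> is_trig_mx W^T ->
  (forall i, 0 < W i i) -> (T *m (L *m W))^T *m (T *m (L *m W)) = 1%:M ->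
  frame T L = L *m W.
Proof.
move=> uT uL tW W0 QE; have uW : upu W by split=> // i; rewrite gt_eqF.
have vW := upu_unit uW; have [tV _] := upuV uW.
rewrite /frame; suff -> : chol ((T *m L)^T *m (T *m L)) = invmx W by rewrite invmxK.
rewrite -[RHS]chol_eq // => [|i]; last by rewrite upuV_diag // invr_gt0.
by congr chol; rewrite (@orthogonal_gram (T *m L)) // -mulmxA.
Qed.

Lemma frame_unit T L : unil T -> unil L -> frame T L \in unitmx.
Proof.
move=> uT uL; have [_ [W [uW _ ->]]] := frame_spec uT uL.
by rewrite unitmx_mul unil_unit // upu_unit.
Qed.

Lemma frame_piv T L : unil T -> unil L -> piv (frame T L) != 0.
Proof.
move=> uT uL; have [_ [W [uW _ ->]]] := frame_spec uT uL.
by have [tL L1] := uL; apply: piv_lu => // i; rewrite L1 oner_neq0.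
Qed.

Lemma frame_eigen e T L : unil T -> unil L ->
  frame T L *m chart_inv e T L = diag_mx e *m frame T L.
Proof.
by move=> uT uL; rewrite /chart_inv /= !mulmxA mulmxV ?frame_unit // mul1mx.
Qed.

(* The eigenvector matrix [X] matters only up to left multiplication by a
   diagonal matrix; [nscale X] is the representative making [nT X *m X]
   orthogonal and the upper factor of [X] positive on the diagonal. *)
Definition nscale X : 'rV[R]_n :=
  let u i := (invmx (luL X) *m X) i i in
  let d i := (invmx (luL (X *m X^T)) *m (X *m X^T)) i i in
  \row_i (u i / Num.sqrt (u i ^+ 2 * d i)).

Definition dconj (d : 'rV[R]_n) (A : 'M[R]_n) : 'M[R]_n := \matrix_(i, j) (d 0 i * A i j / d 0 j).

(** Replacing [X] by [d X] with [d] diagonal conjugates by [d] the unipotent lower factors of [X]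
    and of [X X^T]. So these are the coordinates of the normalized representative, written with the
    factors of the original [X]. *)
Definition nL X := dconj (nscale X) (luL X).
Definition nT X := dconj (nscale X) (invmx (luL (X *m X^T))).

Lemma dconjE (d : 'rV[R]_n) (A : 'M[R]_n) : (forall i, d 0 i != 0) ->
  dconj d A *m diag_mx d = diag_mx d *m A.
Proof.
move=> d0; apply/matrixP => i j; rewrite mul_diag_mx mul_mx_diag !mxE.
by rewrite mulfVK.
Qed.

Lemma dconj_unil (d : 'rV[R]_n) (A : 'M[R]_n) : (forall i, d 0 i != 0) ->
  unil A -> unil (dconj d A).
Proof.
move=> d0 [/is_trig_mxP tA A1]; split=> [|i]; last by rewrite mxE A1 mulr1 divff.
by apply/is_trig_mxP => i j ij; rewrite mxE tA // mulr0 mul0r.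
Qed.

Lemma piv_unit X : piv X != 0 -> X \in unitmx.
Proof.
by move=> /lu_exists[U uU ->]; rewrite unitmx_mul (upu_unit uU) unil_unit //; exact: luL_unil.
Qed.

Lemma posdef_gramC X : X \in unitmx -> posdef (X *m X^T).
Proof. by move=> uX; rewrite -{1}[X]trmxK; apply: posdef_gram; rewrite unitmx_tr. Qed.

Lemma nscale_neq0 X i : piv X != 0 -> nscale X 0 i != 0.
Proof.
move=> pX; have [_ U0] := luU_upu pX.
have d0 := posdef_lu_diag i (posdef_gramC (piv_unit pX)).
rewrite mxE mulf_neq0 // invr_neq0 // gt_eqF // sqrtr_gt0 mulr_gt0 //.
by rewrite lt0r sqrf_eq0 U0 sqr_ge0.
Qed.

Lemma nL_unil X : piv X != 0 -> unil (nL X).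
Proof. by move=> pX; apply: dconj_unil (luL_unil X) => i; exact: nscale_neq0. Qed.

Lemma nT_unil X : piv X != 0 -> unil (nT X).
Proof.
by move=> pX; apply: dconj_unil (unilV (luL_unil _)) => i; exact: nscale_neq0.
Qed.

(** If [X X^T = N D N^T] with [N] unipotent, the rows of [N^-1 X] are orthogonal with squared
    lengths [D i i]. The scale is therefore the sign of [u i] over the square root of [D i i]; the
    form [u / sqrt (u^2 D)] expresses it without a sign function, within reach of the smoothness
    rules. *)
Lemma frame_norm X : piv X != 0 ->
  frame (nT X) (nL X) = diag_mx (nscale X) *m X.
Proof.
move=> pX; have d0 i := nscale_neq0 i pX; have uL := luL_unil X.
have vL := unil_unit uL; have uU := luU_upu pX; have [tU U0] := uU.
have pA := posdef_gramC (piv_unit pX).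
pose d := nscale X; pose S := X *m X^T; pose N := luL S.
have vN : N \in unitmx := unil_unit (luL_unil _).
have XE : diag_mx d *m X = nL X *m (diag_mx d *m (invmx (luL X) *m X)).
  by rewrite mulmxA dconjE // -mulmxA mulKVmx.
rewrite XE; have td : is_trig_mx (diag_mx d)^T by rewrite tr_diag_mx diag_mx_is_trig.
apply: frame_eq; [exact: nT_unil|exact: nL_unil|exact: upper_mulmx| |].
  move=> i; rewrite upu_diag // diag_mxii /d mxE mulrAC -expr2.
  have d1 := posdef_lu_diag i pA.
  have u2 : 0 < ((invmx (luL X) *m X) i i) ^+ 2 by rewrite lt0r sqrf_eq0 U0 sqr_ge0.
  by rewrite divr_gt0 // sqrtr_gt0 mulr_gt0.
rewrite -XE; apply: mulmx1C; rewrite mulmxA dconjE // -/S -/N -mulmxA.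
rewrite !trmx_mul tr_diag_mx !mulmxA -(mulmxA (diag_mx d)) -(mulmxA (diag_mx d)).
rewrite -(mulmxA _ X) -/S.
have NE : invmx N *m S *m (invmx N)^T = diag_mx (\row_i (invmx N *m S) i i).
  rewrite {1}[S](ldlt (proj1 pA) (posdef_piv pA)) -/S -/N.
  by rewrite !mulmxA mulVmx // mul1mx -mulmxA -trmx_mul mulVmx // trmx1 mulmx1.
rewrite -(mulmxA (diag_mx d)) NE !mulmx_diag; apply/matrixP => i j.
rewrite [LHS]mxE [RHS]mxE; case: eqVneq => [_|_]; rewrite ?mulr0n // !mulr1n.
rewrite ![(\row__ _) 0 i]mxE -/S -/N.
have := U0 i; have := posdef_lu_diag i pA; rewrite -/S -/N.
set D := (invmx N *m S) i i; set u := (invmx _ *m _) i i => d1 u0.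
have s0 : 0 < u ^+ 2 * D by rewrite mulr_gt0 // lt0r sqrf_eq0 u0 sqr_ge0.
have s2 : Num.sqrt (u ^+ 2 * D) ^+ 2 = u ^+ 2 * D by rewrite sqr_sqrtr // ltW.
have s1 : Num.sqrt (u ^+ 2 * D) != 0 by rewrite gt_eqF // sqrtr_gt0.
have -> : u / Num.sqrt (u ^+ 2 * D) * D * (u / Num.sqrt (u ^+ 2 * D)) =
  (u ^+ 2 * D) / Num.sqrt (u ^+ 2 * D) ^+ 2 by field.
by rewrite s2 divff // gt_eqF.
Qed.

Lemma chart_inv_norm e X M : piv X != 0 -> X *m M = diag_mx e *m X ->
  chart_inv e (nT X) (nL X) = M.
Proof.
move=> pX XM; have uX := piv_unit pX.
have ud : diag_mx (nscale X) \in unitmx.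
  rewrite trig_unitmx ?diag_mx_is_trig //; apply/forallP => i.
  by rewrite diag_mxii nscale_neq0.
rewrite /chart_inv frame_norm //; set d := diag_mx _ in ud *.
apply: (can_inj (mulKmx (_ : d *m X \in unitmx))); first by rewrite unitmx_mul ud.
rewrite -[X in _ *m X]mulmxA mulKVmx ?unitmx_mul ?ud // -mulmxA XM !mulmxA.
by rewrite diag_mxC.
Qed.

Lemma commute_diag e (E : 'M[R]_n) : injective (e 0) ->
  E *m diag_mx e = diag_mx e *m E -> is_diag_mx E.
Proof.
move=> ei /matrixP EE; apply/is_diag_mxP => i j ij.
have := EE i j; rewrite mul_diag_mx mul_mx_diag !mxE => /eqP.
rewrite mulrC -subr_eq0 -mulrBl mulf_eq0 subr_eq0 => /orP[/eqP/ei|/eqP//].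
by move=> ji; move: ij; rewrite ji eqxx.
Qed.

(** [E = X' X^-1] commutes with [diag_mx e], so it is diagonal. Comparing LU factorizations of
    [E X = X'] makes its entries positive. Moreover [P = T' E T^-1] carries one orthogonal matrix to
    another and is lower triangular with the diagonal of [E]; orthogonal and triangular, it is
    diagonal with entries of square 1. So [E = P = 1]. *)
Lemma chart_inv_inj e T L T' L' : injective (e 0) ->
  unil T -> unil L -> unil T' -> unil L' ->
  chart_inv e T L = chart_inv e T' L' -> T = T' /\ L = L'.
Proof.
move=> ei uT uL uT' uL' EM.
have := frame_eigen e uT uL; have := frame_eigen e uT' uL'; rewrite -EM.
have vX := frame_unit uT uL; have vX' := frame_unit uT' uL'.
have [Q1 [W [uW W0 XE]]] := frame_spec uT uL.
have [Q1' [W' [uW' W0' XE']]] := frame_spec uT' uL'.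
set X := frame T L in vX Q1 XE *; set X' := frame T' L' in vX' Q1' XE' *.
set M := chart_inv e T L => XM' XM.
have [E EX] : exists E, E *m X = X' by exists (X' *m invmx X); rewrite mulmxKV.
have dE : is_diag_mx E.
  apply: (commute_diag ei); apply: (can_inj (mulmxK vX)).
  by rewrite -!mulmxA EX -XM' -XM (mulmxA E) EX.
have uE : E \in unitmx by move: vX'; rewrite -EX unitmx_mul => /andP[].
have [f Ef] : exists f, E = diag_mx f.
  by exists (\row_i E i i); apply/matrixP => i j; rewrite !mxE;
     case: eqVneq => [->|ij] //; rewrite (is_diag_mxP dE).
have f0 i : f 0 i != 0.
  move: uE; rewrite Ef trig_unitmx ?diag_mx_is_trig // => /forallP/(_ i).
  by rewrite mxE eqxx.
have udf : upu (diag_mx f).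
  by split=> [|i]; rewrite ?tr_diag_mx ?diag_mx_is_trig // diag_mxii.
have EL : dconj f L *m (diag_mx f *m W) = L' *m W'.
  by rewrite mulmxA dconjE // -mulmxA -XE -Ef EX XE'.
have [LE WE] := lu_unique (dconj_unil f0 uL) uL' (upuM udf uW) uW' EL.
have fpos i : 0 < f 0 i.
  have := W0' i; rewrite -WE upu_diag; [|by case: udf|by case: uW].
  by rewrite mxE eqxx pmulr_lgt0.
pose P := T' *m E *m invmx T.
have PE : P *m (T *m X) = T' *m X'.
  by rewrite /P -!mulmxA (mulmxA (invmx T)) mulVmx ?unil_unit // mul1mx EX.
have uP : P \in unitmx by rewrite !unitmx_mul !unitmx_inv uE !unil_unit.
have PP : P^T *m P = 1%:M.
  have vQ : T *m X \in unitmx by rewrite unitmx_mul vX unil_unit.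
  apply: (can_inj (mulmxK vQ)); apply: (can_inj (mulKmx (_ : (T *m X)^T \in unitmx))).
    by rewrite unitmx_tr.
  by rewrite mul1mx Q1 -mulmxA PE mulmxA -trmx_mul PE Q1'.
have tP : is_trig_mx P.
  by apply: trig_mulmx; [apply: trig_mulmx; [by case: uT'|exact: is_diag_mx_is_trig]
                        |by case: (unilV uT)].
have tPT : is_trig_mx P^T.
  have -> : P^T = invmx P by rewrite -[LHS](mulmxK uP) PP mul1mx.
  exact: trig_invmx.
have Pd i : P i i = f 0 i.
  have [tV V1] := unilV uT; have [tT' T1'] := uT'.
  rewrite trig_mulmx_diag //; last exact: trig_mulmx tT' (is_diag_mx_is_trig dE).
  rewrite V1 mulr1 (trig_mulmx_diag i tT' (is_diag_mx_is_trig dE)) T1' mul1r.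
  by rewrite Ef diag_mxii.
have f1 i : f 0 i = 1.
  have /matrixP/(_ i i) := PP; rewrite trig_mulmx_diag // [X in X * _]mxE [RHS]mxE eqxx Pd.
  by move=> /eqP; rewrite -expr2 sqrf_eq1 => /orP[/eqP//|/eqP fi];
    have := fpos i; rewrite fi ltr0N1.
have Ef1 : E = 1%:M.
  by rewrite Ef; apply/matrixP => i j; rewrite !mxE f1.
have P1 : P = 1%:M.
  apply/matrixP => i j; rewrite [RHS]mxE; have [ij|ji|/val_inj ->] := ltngtP i j.
  - by rewrite trig0 // -val_eqE (ltn_eqF ij).
  - by have := trig0 tPT ji; rewrite mxE => ->; rewrite -val_eqE (gtn_eqF ji).
  - by rewrite Pd f1 eqxx.
split; last first.
  by rewrite -LE; apply/matrixP => i j; rewrite !mxE !f1 mul1r divr1.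
by rewrite -[LHS]mul1mx -P1 /P Ef1 mulmx1 mulmxKV // unil_unit.
Qed.

End Charts.

(** * Smoothness of the matrix factorizations and of the coordinates *)

Section SmoothMatrix.
Context {R : realType}.

Lemma Ck_coord m n k (U : set 'M[R]_(m, n)) i j : open U ->
  Ck_on k U (fun M : 'M[R]_(m, n) => M i j).
Proof.
move=> oU; apply: (Ck_mxP k id oU).1 => //.
by apply: (@Ck_linear R _ _ k U idfun) => x; exact: cvg_id.
Qed.

Context {V : normedModType R} {k : nat} {U : set V} (oU : open U).

Lemma Ck_sum (I : Type) (r : seq I) (P : pred I) (f : I -> V -> R) :
  (forall i, Ck_on k U (f i)) -> Ck_on k U (fun x => \sum_(i <- r | P i) f i x).
Proof.
move=> Cf; elim: r => [|i r IH].
  by under eq_fun do rewrite big_nil; exact: Ck_cst.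
under eq_fun do rewrite big_cons.
by case: (P i) => //; exact: CkD.
Qed.

Lemma Ck_prod (I : Type) (r : seq I) (P : pred I) (f : I -> V -> R) :
  (forall i, Ck_on k U (f i)) -> Ck_on k U (fun x => \prod_(i <- r | P i) f i x).
Proof.
move=> Cf; elim: r => [|i r IH].
  by under eq_fun do rewrite big_nil; exact: Ck_cst.
under eq_fun do rewrite big_cons.
by case: (P i) => //; exact: CkM.
Qed.

Lemma CkN (f : V -> R) : Ck_on k U f -> Ck_on k U (fun x => - f x).
Proof.
move=> Cf; under eq_fun do rewrite -mulN1r.
by apply: CkM => //; exact: Ck_cst.
Qed.

Lemma Ck_mulmx m n p (A : V -> 'M[R]_(m, n)) (B : V -> 'M[R]_(n, p)) :
  Ck_on k U A -> Ck_on k U B -> Ck_on k U (fun x => A x *m B x).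
Proof.
move=> /(Ck_mxP _ _ oU) CA /(Ck_mxP _ _ oU) CB; apply/(Ck_mxP _ _ oU) => i j.
by under eq_fun do rewrite mxE; apply: Ck_sum => l; exact: CkM.
Qed.

Lemma Ck_tr m n (A : V -> 'M[R]_(m, n)) :
  Ck_on k U A -> Ck_on k U (fun x => (A x)^T).
Proof.
move=> /(Ck_mxP _ _ oU) CA; apply/(Ck_mxP _ _ oU) => i j.
by under eq_fun do rewrite mxE.
Qed.

Lemma Ck_det n (A : V -> 'M[R]_n) :
  Ck_on k U A -> Ck_on k U (fun x => \det (A x)).
Proof.
move=> /(Ck_mxP _ _ oU) CA; apply: Ck_sum => s; apply: CkM => //.
  exact: Ck_cst.
exact: Ck_prod.
Qed.

(** Cramer's rule. [invmx] obeys it only on invertible matrices, so the formula is transferred on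
    [U] alone. *)
Lemma Ck_invmx n (A : V -> 'M[R]_n) : (forall x, U x -> A x \in unitmx) ->
  Ck_on k U A -> Ck_on k U (fun x => invmx (A x)).
Proof.
move=> uA CA; have CA' := (Ck_mxP _ _ oU).1 CA; apply/(Ck_mxP _ _ oU) => i j.
have CV : Ck_on k U (fun x => (\det (A x))^-1).
  by apply: CkV (Ck_det CA) => // x Ux; rewrite -unitfE -unitmxE uA.
have CC : Ck_on k U (fun x => cofactor (A x) j i).
  apply: CkM => //; first exact: Ck_cst.
  apply: Ck_det; apply/(Ck_mxP _ _ oU) => a b.
  by under eq_fun do rewrite !mxE.
apply: Ck_ext (CkM oU CV CC) => // x Ux.
by rewrite /invmx uA // !mxE.
Qed.

Lemma Ck_diag_mx n (d : V -> 'rV[R]_n) :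
  Ck_on k U d -> Ck_on k U (fun x => diag_mx (d x)).
Proof.
move=> /(Ck_mxP _ _ oU) Cd; apply/(Ck_mxP _ _ oU) => i j.
under eq_fun do rewrite mxE; case: eqVneq => _.
  by under eq_fun do rewrite mulr1n.
by under eq_fun do rewrite mulr0n; exact: Ck_cst.
Qed.

Lemma Ck_schur n (A : V -> 'M[R]_n.+1) :
  Ck_on k U A -> Ck_on k U (fun x => schur (A x)).
Proof.
move=> /(Ck_mxP _ _ oU) CA; apply/(Ck_mxP _ _ oU) => i j.
under eq_fun do rewrite mxE.
by apply: CkD => //; [exact: CkM|apply: CkN; exact: CkM].
Qed.

Lemma Ck_piv n (A : V -> 'M[R]_n) :
  Ck_on k U A -> Ck_on k U (fun x => piv (A x)).
Proof.
elim: n A => [|n IH] A CA /=; first exact: Ck_cst.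
apply: CkM => //; first exact: (Ck_mxP _ _ oU).1 CA _ _.
exact/IH/Ck_schur.
Qed.

Lemma Ck_luL n (A : V -> 'M[R]_n) : (forall x, U x -> piv (A x) != 0) ->
  Ck_on k U A -> Ck_on k U (fun x => luL (A x)).
Proof.
elim: n A => [|n IH] A pA CA //=.
have CA' := (Ck_mxP _ _ oU).1 CA.
have CL : Ck_on k U (fun x => luL (schur (A x))).
  apply: IH; last exact: Ck_schur.
  by move=> x /pA /=; rewrite mulf_eq0 negb_or => /andP[].
apply/(Ck_mxP _ _ oU) => i j; under eq_fun do rewrite mxE.
case: unliftP => [i' _|_]; last exact: Ck_cst.
case: unliftP => [j' _|_]; first exact: (Ck_mxP _ _ oU).1 CL _ _.
apply: CkM => //; apply: CkV => // x /pA /=.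
by rewrite mulf_eq0 negb_or => /andP[].
Qed.

Lemma Ck_lu_diag n (A : V -> 'M[R]_n) i : (forall x, U x -> piv (A x) != 0) ->
  Ck_on k U A -> Ck_on k U (fun x => (invmx (luL (A x)) *m A x) i i).
Proof.
move=> pA CA; have CU : Ck_on k U (fun x => invmx (luL (A x)) *m A x).
  apply: Ck_mulmx => //; apply: Ck_invmx (Ck_luL pA CA) => x _.
  exact: unil_unit (luL_unil _).
by have /(Ck_mxP _ _ oU)/(_ i i) := CU.
Qed.

Lemma Ck_chol n (A : V -> 'M[R]_n) : (forall x, U x -> posdef (A x)) ->
  Ck_on k U A -> Ck_on k U (fun x => chol (A x)).
Proof.
move=> pA CA; have vA x : U x -> piv (A x) != 0 by move=> /pA/posdef_piv.
apply: Ck_mulmx; last exact/Ck_tr/Ck_luL.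
apply: Ck_diag_mx; apply/(Ck_mxP _ _ oU) => i j; under eq_fun do rewrite mxE.
apply: Ck_sqrt => // [x Ux|]; last exact: Ck_lu_diag.
exact/posdef_lu_diag/pA.
Qed.

Lemma Ck_frame n (T L : V -> 'M[R]_n) :
  (forall x, U x -> unil (T x)) -> (forall x, U x -> unil (L x)) ->
  Ck_on k U T -> Ck_on k U L -> Ck_on k U (fun x => frame (T x) (L x)).
Proof.
move=> uT uL CT CL.
have pG x : U x -> posdef ((T x *m L x)^T *m (T x *m L x)).
  by move=> Ux; apply: posdef_gram; rewrite unitmx_mul !unil_unit; auto.
apply: Ck_mulmx => //; apply: Ck_invmx => [x /pG/chol_spec[tV V0 _]|].
  by apply: upu_unit; split=> // i; rewrite gt_eqF.
apply: Ck_chol => //; apply: Ck_mulmx; first apply: Ck_tr; exact: Ck_mulmx.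
Qed.

Lemma Ck_chart_inv n (e : 'rV[R]_n) (T L : V -> 'M[R]_n) :
  (forall x, U x -> unil (T x)) -> (forall x, U x -> unil (L x)) ->
  Ck_on k U T -> Ck_on k U L -> Ck_on k U (fun x => chart_inv e (T x) (L x)).
Proof.
move=> uT uL CT CL; have CX := Ck_frame uT uL CT CL.
apply: Ck_mulmx => //; apply: Ck_mulmx; last exact: Ck_cst.
by apply: Ck_invmx CX => x Ux; exact: frame_unit (uT x Ux) (uL x Ux).
Qed.

Lemma Ck_dconj n (d : V -> 'rV[R]_n) (A : V -> 'M[R]_n) :
  (forall x i, U x -> d x 0 i != 0) ->
  Ck_on k U d -> Ck_on k U A -> Ck_on k U (fun x => dconj (d x) (A x)).
Proof.
move=> d0 /(Ck_mxP _ _ oU) Cd /(Ck_mxP _ _ oU) CA.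
apply/(Ck_mxP _ _ oU) => i j; under eq_fun do rewrite mxE.
apply: CkM => //; first exact: CkM.
by apply: CkV => // x Ux; exact: d0.
Qed.

Section Normalized.
Variables (n : nat) (X : V -> 'M[R]_n).
Hypotheses (pX : forall x, U x -> piv (X x) != 0) (CX : Ck_on k U X).

Let CS : Ck_on k U (fun x => X x *m (X x)^T).
Proof. by apply: Ck_mulmx => //; exact: Ck_tr. Qed.

Let pS x : U x -> posdef (X x *m (X x)^T).
Proof. by move=> /pX/piv_unit/posdef_gramC. Qed.

Let vS x : U x -> piv (X x *m (X x)^T) != 0.
Proof. by move=> /pS/posdef_piv. Qed.

Lemma Ck_nscale : Ck_on k U (fun x => nscale (X x)).
Proof.
apply/(Ck_mxP _ _ oU) => i j; under eq_fun do rewrite mxE.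
have Cu := Ck_lu_diag j pX CX; have Cd := Ck_lu_diag j vS CS.
have p0 x : U x -> 0 < (invmx (luL (X x)) *m X x) j j ^+ 2 *
    (invmx (luL (X x *m (X x)^T)) *m (X x *m (X x)^T)) j j.
  move=> Ux; have [_ U0] := luU_upu (pX Ux).
  rewrite mulr_gt0 //; last exact: posdef_lu_diag (pS Ux).
  by rewrite lt0r sqrf_eq0 U0 sqr_ge0.
apply: CkM => //; apply: CkV => // [x /p0|]; first by rewrite -sqrtr_gt0 => /lt0r_neq0.
by apply: Ck_sqrt => //; apply: CkM => //; exact: CkM.
Qed.

Lemma Ck_nL : Ck_on k U (fun x => nL (X x)).
Proof.
apply: Ck_dconj => [x i /pX|//|]; [exact: nscale_neq0|exact: Ck_nscale|].
exact: Ck_luL.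
Qed.

Lemma Ck_nT : Ck_on k U (fun x => nT (X x)).
Proof.
apply: Ck_dconj => [x i /pX|//|]; [exact: nscale_neq0|exact: Ck_nscale|].
by apply: Ck_invmx (Ck_luL vS CS) => x _; exact: unil_unit (luL_unil _).
Qed.

End Normalized.

End SmoothMatrix.

(** * Derivatives of matrix-valued curves *)

Section CurveDerivatives.
Context {R : realType}.

Lemma is_derive_mxP (V : normedModType R) m n (A : V -> 'M[R]_(m, n)) (t v : V) A' :
  is_derive t v A A' <-> forall i j, is_derive t v (fun s => A s i j) (A' i j).
Proof.
split=> [[dA <-] i j|H].
  have dAij := (derivable_mxP A t v).1 dA i j.
  by apply: DeriveDef => //; rewrite derive_mx // mxE.
have dA : derivable A t v.
  by apply/derivable_mxP => i j; have [] := H i j.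
by apply: DeriveDef => //; rewrite derive_mx //; apply/matrixP => i j;
  rewrite mxE; have [_ ->] := H i j.
Qed.

Lemma is_derive_mulmx m n p (A : R -> 'M[R]_(m, n)) (B : R -> 'M[R]_(n, p)) t A' B' :
  is_derive t (1 : R) A A' -> is_derive t (1 : R) B B' ->
  is_derive t (1 : R) (fun s => A s *m B s) (A' *m B t + A t *m B').
Proof.
move=> /is_derive_mxP dA /is_derive_mxP dB; apply/is_derive_mxP => i j.
have -> : (fun s => (A s *m B s) i j) =
    \sum_(l < n) ((fun s => A s i l) * (fun s => B s l j)).
  by apply/funext => s; rewrite mxE fct_sumE.
apply: (is_derive_eq (is_derive_sum (fun l => is_deriveM (dA i l) (dB l j)))).
rewrite !mxE -big_split /=; apply: eq_bigr => l _.
by rewrite addrC; congr (_ + _); exact: mulrC.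
Qed.

Lemma is_derive_tr m n (A : R -> 'M[R]_(m, n)) t A' :
  is_derive t (1 : R) A A' -> is_derive t (1 : R) (fun s => (A s)^T) A'^T.
Proof.
move=> /is_derive_mxP dA; apply/is_derive_mxP => i j; rewrite mxE.
by under eq_fun do rewrite mxE; exact: dA.
Qed.

Lemma is_derive_unique (V : normedModType R) (f : R -> V) t a b :
  is_derive t (1 : R) f a -> is_derive t (1 : R) f b -> a = b.
Proof. by move=> [_ <-] [_ <-]. Qed.

(** Supplies derivatives of the frame and of its upper factor along the flow without computing them;
    only identities between them matter later. *)
Lemma C1_is_derive (V : normedModType R) (f : R -> V) t :
  Ck_on 1 setT f -> is_derive t (1 : R) f ('D_1 f t).
Proof. by move=> [df _]; apply: DeriveDef => //; apply/derivable1_diffP/df. Qed.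

Lemma is_derive_expZ (a x : R) :
  is_derive x (1 : R) (fun s => expR (s * a)) (a * expR (x * a)).
Proof.
have dM : is_derive x (1 : R) (fun s : R => s * a) a.
  have -> : (fun s : R => s * a) = a *: (id : R -> R).
    by apply/funext => s; exact: mulrC.
  by apply: is_derive_eq (is_deriveZ a (is_derive_id x 1)) _; exact: mulr1.
by rewrite [a * _]mulrC; exact: is_derive1_comp (is_derive_expR _) dM.
Qed.

Lemma C1_expZ (a : R) : Ck_on 1 setT (fun s : R => expR (s * a)).
Proof.
have df x : differentiable (fun s : R => expR (s * a)) x.
  by apply/derivable1_diffP; have [] := is_derive_expZ a x.
split=> [//|v].
have -> : (fun x => 'D_v (fun s : R => expR (s * a)) x) =
    (v * a) *: (fun s => expR (s * a)).
  apply/funext => x; rewrite deriveE // deriv1E; last exact/derivable1_diffP.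
  by rewrite derive1E; have [_ ->] := is_derive_expZ a x; exact: mulrA.
move=> x _; apply: continuousZl_tmp; exact: differentiable_continuous.
Qed.

End CurveDerivatives.

(** * The explicit Toda solutions in the coordinates *)

Section Toda.
Context {R : realType} {n : nat}.
Implicit Types (T L X M : 'M[R]_n.+1) (e : 'rV[R]_n.+1) (p : {poly R}).

Definition zflow e p L (t : R) : 'M[R]_n.+1 :=
  \matrix_(i, j) (expR (t * (p.[e 0 i] - p.[e 0 j])) * L i j).

Lemma zflow_unil e p L t : unil L -> unil (zflow e p L t).
Proof.
move=> [/is_trig_mxP tL L1]; split=> [|i].
  by apply/is_trig_mxP => i j ij; rewrite mxE tL ?mulr0.
by rewrite mxE subrr mulr0 expR0 mul1r.
Qed.

Lemma C1_zflow e p L : Ck_on 1 setT (zflow e p L).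
Proof.
apply/(Ck_mxP _ _ openT) => i j; under eq_fun do rewrite mxE.
by apply: (CkM openT); [exact: C1_expZ|exact: Ck_cst].
Qed.

Lemma is_derive_zflow e p L t : let P := diag_mx (map_mx (horner p) e) in
  is_derive t (1 : R) (zflow e p L) (P *m zflow e p L t - zflow e p L t *m P).
Proof.
move=> P; apply/is_derive_mxP => i j; under eq_fun do rewrite mxE.
have -> : (fun s => expR (s * (p.[e 0 i] - p.[e 0 j])) * L i j) =
    L i j *: (fun s => expR (s * (p.[e 0 i] - p.[e 0 j]))).
  by apply/funext => s; exact: mulrC.
apply: is_derive_eq (is_deriveZ _ (is_derive_expZ _ _)) _.
rewrite mul_diag_mx mul_mx_diag !mxE; set a := expR _; set b := L i j.
suff -> : b *: ((p.[e 0 i] - p.[e 0 j]) * a) = b * ((p.[e 0 i] - p.[e 0 j]) * a) by ring.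
by [].
Qed.

Lemma horner_chart_inv e p T L : unil T -> unil L ->
  frame T L *m horner_mx (chart_inv e T L) p =
  diag_mx (map_mx (horner p) e) *m frame T L.
Proof.
move=> uT uL; have vX := frame_unit uT uL.
rewrite /chart_inv horner_mx_uconjC // horner_mx_diag !mulmxA mulmxV // mul1mx.
by [].
Qed.

(* With X = frame T (L t), the matrix K = X^-1 X' is skew because T X is
   orthogonal, and p(M) - K is upper triangular because X = L W with W upper
   triangular; hence K is the projection of p(M), and X M = diag(e) X gives
   M' = M K - K M. *)
Lemma toda_chart_inv e p T L t : unil T -> unil L ->
  is_derive t (1 : R) (fun s => chart_inv e T (zflow e p L s))
    (toda_field p (chart_inv e T (zflow e p L t))).
Proof.
move=> uT uL; pose Z := zflow e p L; pose X s := frame T (Z s).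
pose M s := chart_inv e T (Z s); pose P := diag_mx (map_mx (horner p) e).
have uZ s : unil (Z s) by exact: zflow_unil.
have vX s : X s \in unitmx by exact: frame_unit.
have vZ s : Z s \in unitmx by exact: unil_unit.
have CT : Ck_on 1 setT (fun _ : R => T) by exact: Ck_cst.
have CZ : Ck_on 1 setT Z by exact: C1_zflow.
have CX : Ck_on 1 setT X.
  exact: (Ck_frame openT (fun _ _ => uT) (fun s _ => uZ s) CT CZ).
have dX := C1_is_derive t CX.
have dM := C1_is_derive t
  (Ck_chart_inv openT e (fun _ _ => uT) (fun s _ => uZ s) CT CZ).
have CW : Ck_on 1 setT (fun s => invmx (Z s) *m X s).
  have CZV := Ck_invmx openT (fun s (_ : setT s) => vZ s) CZ.
  exact: (Ck_mulmx openT CZV CX).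
have dW := C1_is_derive t CW;
have dZ : is_derive t (1 : R) Z (P *m Z t - Z t *m P) by exact: is_derive_zflow.
move: dX dM dW; set X' := 'D_1 _ t; set M' := 'D_1 _ t; set W' := 'D_1 _ t.
pose W s := invmx (Z s) *m X s; move=> dX dM dW.
have XW s : Z s *m W s = X s by rewrite mulKVmx.
have tW s : is_trig_mx (W s)^T.
  have [_ [V [[tV _] _ XV]]] := frame_spec uT (uZ s).
  by rewrite /W /X XV mulKmx.
have tW' : is_trig_mx W'^T.
  apply/is_trig_mxP => i j ij; rewrite mxE.
  have /is_derive_mxP/(_ j i) := dW; have -> : (fun s => W s j i) = cst 0.
    by apply/funext => s; have := trig0 (tW s) ij; rewrite mxE.
  by move/is_derive_unique; apply; exact: is_derive_cst.
pose K := invmx (X t) *m X'.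
have X'E : X' = X t *m K by rewrite mulKVmx.
(* Differentiating [X = Z W] with [Z' = P Z - Z P] gives [P X = X' + Z (P W - W')], and
   [X p(M) = P X]. The remainder is thus [W^-1 (P W - W')], upper triangular like [W] and [W']. *)
have pM : horner_mx (M t) p = K + (invmx (X t) *m (Z t *m (P *m W t - W'))).
  apply: (can_inj (mulKmx (vX t))); rewrite horner_chart_inv // mulmxDr -X'E mulKVmx //.
  have := is_derive_mulmx dZ dW; rewrite -/W.
  have -> : (fun s => Z s *m (invmx (Z s) *m X s)) = X by apply/funext => s; exact: XW.
  move=> /(is_derive_unique dX) ->.
  rewrite mulmxBl -(mulmxA P) XW mulmxBr (mulmxA (Z t) P) -/P -/(X t) -/(W t).
  rewrite -addrA (addrCA (Z t *m W')).
  by rewrite subrr addr0 addrNK.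
have upK : upper_triangular (invmx (X t) *m (Z t *m (P *m W t - W'))).
  have vW : W t \in unitmx by rewrite unitmx_mul unitmx_inv vZ vX.
  have -> : invmx (X t) *m (Z t *m (P *m W t - W')) = invmx (W t) *m (P *m W t - W').
    apply: (can_inj (mulKmx (vX t))); rewrite mulKVmx // -[X t]XW -mulmxA.
    by rewrite mulKVmx.
  apply: upper_mulmx; first by rewrite trmx_inv trig_invmx ?unitmx_tr.
  have tPW : is_trig_mx (P *m W t)^T.
    by apply: upper_mulmx => //; rewrite tr_diag_mx diag_mx_is_trig.
  by apply/is_trig_mxP => i j ij; have := trig0 tPW ij; have := trig0 tW' ij;
    rewrite !mxE => -> ->; rewrite subrr.
have skK : Defs.skew K.
  have dQ := is_derive_mulmx (is_derive_cst T t 1) dX.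
  have := is_derive_mulmx (is_derive_tr dQ) dQ.
  have QQ s : (T *m X s)^T *m (T *m X s) = 1%:M by have [] := frame_spec uT (uZ s).
  have -> : (fun s => (T *m X s)^T *m (T *m X s)) = cst 1%:M.
    by apply/funext => s; exact: QQ.
  move/(is_derive_unique (is_derive_cst _ _ _))/esym.
  rewrite /= mul0mx add0r X'E.
  rewrite [T *m (X t *m K)]mulmxA (trmx_mul (T *m X t) K) -(mulmxA K^T).
  rewrite [(T *m X t)^T *m (T *m X t *m K)]mulmxA QQ mulmx1 mul1mx.
  by move/eqP; rewrite addr_eq0 => /eqP.
have KE : proj_skew (horner_mx (M t) p) = K := proj_skew_unique skK upK pM.
apply: (is_derive_eq dM); rewrite /toda_field KE -/(M t).
have := is_derive_mulmx dX dM; have XM s : X s *m M s = diag_mx e *m X s.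
  exact: frame_eigen.
have -> : (fun s => X s *m M s) = (fun s => diag_mx e *m X s) by apply/funext.
move/(is_derive_unique (is_derive_mulmx (is_derive_cst (diag_mx e) t 1) dX)).
rewrite mul0mx add0r X'E (mulmxA (diag_mx e)) -XM => E.
apply: (can_inj (mulKmx (vX t))).
rewrite mulmxBr (mulmxA (X t) (M t)) E (mulmxA (X t) K) addrC.
by rewrite addKr.
Qed.

End Toda.

(** * Uniqueness for locally Lipschitz differential equations *)

Section OdeUniqueness.
Context {R : realType}.

(** [u s * expR (s * K)] is nondecreasing and [u s * expR (- s * K)] nonincreasing, so a zero at
    either end spreads to the other. Both directions are needed since the initial time may lie on
    either side. *)
Lemma gronwall0 (u du : R -> R) (K a b : R) : a <= b ->
  (forall s, a <= s <= b -> is_derive s (1 : R) u (du s)) ->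
  (forall s, a <= s <= b -> 0 <= u s /\ `|du s| <= K * u s) ->
  u a = 0 \/ u b = 0 -> u a = 0 /\ u b = 0.
Proof.
move=> ab dU bU.
have dv (k : R) s : a <= s <= b ->
    is_derive s (1 : R) (fun x => u x * expR (x * k))
      (expR (s * k) * (du s + k * u s)).
  move=> /dU dUs; apply: is_derive_eq (is_deriveM dUs (is_derive_expZ k s)) _.
  suff : u s * (k * expR (s * k)) + expR (s * k) * du s =
    expR (s * k) * (du s + k * u s) by [].
  by ring.
have cv (k : R) : {within `[a, b], continuous (fun x => u x * expR (x * k))}.
  apply: continuous_in_subspaceT => s; rewrite inE /= in_itv /= => /(dv k)[+ _].
  by move=> /derivable1_diffP/differentiable_continuous.
have itv s : s \in `]a, b[ -> a <= s <= b.
  by rewrite in_itv /= => /andP[/ltW -> /ltW ->].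
have e0 x : 0 < expR x :> R := expR_gt0 x.
have [ua ub] : 0 <= u a /\ 0 <= u b by split; apply bU; rewrite lexx ab.
have mono : u a * expR (a * K) <= u b * expR (b * K).
  apply: (ger0_derive1_ndecr _ _ (cv K)) => // s /itv sab.
    by have [] := dv K s sab.
  rewrite derive1E; have [_ ->] := dv K s sab; have [_] := bU s sab.
  rewrite ler_norml => /andP[lb _]; rewrite mulr_ge0 ?(ltW (e0 _)) //.
  by rewrite -lerBlDr sub0r.
have anti : u b * expR (b * - K) <= u a * expR (a * - K).
  apply: (ler0_derive1_nincr _ _ (cv (- K))) => // s /itv sab.
    by have [] := dv (- K) s sab.
  rewrite derive1E; have [_ ->] := dv (- K) s sab; have [_] := bU s sab.
  rewrite ler_norml => /andP[_ ubd]; rewrite mulr_ge0_le0 ?(ltW (e0 _)) //.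
  by rewrite mulNr subr_le0.
case=> u0.
  move: anti; rewrite u0 mul0r pmulr_lle0 // => ub'.
  by split=> //; apply/eqP; rewrite eq_le ub ub'.
move: mono; rewrite u0 mul0r pmulr_lle0 // => ua'.
by split=> //; apply/eqP; rewrite eq_le ua ua'.
Qed.

Lemma mx_entry_le_norm m n (A : 'M[R]_(m, n)) i j : `|A i j| <= `|A|.
Proof.
rewrite [leRHS]/Num.Def.normr /= mx_normrE.
exact: (le_bigmax _ (fun ij : 'I_m * 'I_n => `|A ij.1 ij.2|) (i, j)).
Qed.

Lemma mx_norm_le m n (A : 'M[R]_(m, n)) (c : R) : 0 <= c ->
  (forall i j, `|A i j| <= c) -> `|A| <= c.
Proof.
move=> c0 Ac; rewrite [leLHS]/Num.Def.normr /= mx_normrE.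
by apply: bigmax_le => // -[i j] _; exact: Ac.
Qed.

Lemma mulmx_norm_le m n p (A : 'M[R]_(m, n)) (B : 'M[R]_(n, p)) :
  `|A *m B| <= n%:R * (`|A| * `|B|).
Proof.
apply: mx_norm_le => [|i j]; first by rewrite !mulr_ge0.
rewrite mxE; apply: le_trans (ler_norm_sum _ _ _) _.
apply: (@le_trans _ _ (\sum_(k < n) `|A| * `|B|)).
  by apply: ler_sum => k _; rewrite normrM ler_pM ?mx_entry_le_norm.
by rewrite sumr_const card_ord mulr_natl.
Qed.

(** One constant per ball around the origin: two curves over a compact time interval lie in a common
    ball, and products of such maps stay in the class. *)
Definition locally_lipschitz (V W : normedModType R) (F : V -> W) :=
  forall r : R, exists2 K : R, 0 <= K & forall A B, `|A| <= r -> `|B| <= r ->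
    `|F A - F B| <= K * `|A - B|.

Lemma lipD (V W : normedModType R) (F G : V -> W) :
  locally_lipschitz F -> locally_lipschitz G ->
  locally_lipschitz (fun A => F A + G A).
Proof.
move=> lF lG r; have [K K0 HF] := lF r; have [K' K0' HG] := lG r.
exists (K + K'); first exact: addr_ge0.
move=> A B Ar Br; rewrite opprD addrACA mulrDl.
by apply: le_trans (ler_normD _ _) _; rewrite lerD ?HF ?HG.
Qed.

Lemma lipN (V W : normedModType R) (F : V -> W) :
  locally_lipschitz F -> locally_lipschitz (fun A => - F A).
Proof.
move=> lF r; have [K K0 HF] := lF r; exists K => // A B Ar Br.
by rewrite -opprD normrN HF.
Qed.

Lemma lip_cst (V W : normedModType R) (a : W) : locally_lipschitz (fun _ : V => a).
Proof. by move=> r; exists 0 => // A B _ _; rewrite subrr normr0 mul0r. Qed.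

Lemma lip_id (V : normedModType R) : locally_lipschitz (@id V).
Proof. by move=> r; exists 1 => // A B _ _; rewrite mul1r. Qed.

Lemma lip_bounded (V W : normedModType R) (F : V -> W) r : 0 <= r ->
  locally_lipschitz F ->
  exists2 c : R, 0 <= c & forall A, `|A| <= r -> `|F A| <= c.
Proof.
move=> r0 /(_ r)[K K0 HF]; exists (K * r + `|F 0|).
  by rewrite addr_ge0 ?mulr_ge0.
move=> A Ar; rewrite -[F A](subrK (F 0)).
apply: le_trans (ler_normD _ _) _; rewrite lerD2r.
apply: le_trans (HF _ _ Ar _) _; first by rewrite normr0.
by rewrite subr0 ler_wpM2l.
Qed.

Lemma lip_mulmx (V : normedModType R) m n p (F : V -> 'M[R]_(m, n))
    (G : V -> 'M[R]_(n, p)) : locally_lipschitz F -> locally_lipschitz G ->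
  locally_lipschitz (fun A => F A *m G A).
Proof.
move=> lF lG r; have [r0|r0] := lerP 0 r; last first.
  exists 0 => // A B Ar; have := le_lt_trans Ar r0.
  by rewrite ltNge normr_ge0.
have [K K0 HF] := lF r; have [K' K0' HG] := lG r.
have [c c0 Fc] := lip_bounded r0 lF; have [c' c0' Gc] := lip_bounded r0 lG.
exists (n%:R * (K * c') + n%:R * (c * K')); first by rewrite addr_ge0 ?mulr_ge0.
move=> A B Ar Br.
have -> : F A *m G A - F B *m G B = (F A - F B) *m G A + F B *m (G A - G B).
  by rewrite mulmxBl mulmxBr addrA subrK.
apply: le_trans (ler_normD _ _) _; rewrite mulrDl lerD //.
  apply: le_trans (mulmx_norm_le _ _) _; rewrite -mulrA ler_wpM2l //.
  by rewrite mulrAC ler_pM ?HF ?Gc.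
apply: le_trans (mulmx_norm_le _ _) _; rewrite -mulrA ler_wpM2l //.
by rewrite -mulrA ler_pM ?HG ?Fc.
Qed.

Lemma lip_horner_mx n (p : {poly R}) :
  locally_lipschitz (fun A : 'M[R]_n.+1 => horner_mx A p).
Proof.
elim/poly_ind: p => [|p c IH].
  by under eq_fun do rewrite rmorph0; exact: lip_cst.
under eq_fun do rewrite rmorphD rmorphM /= horner_mx_X horner_mx_C.
by apply: lipD (lip_cst _ _); apply: lip_mulmx IH (@lip_id _).
Qed.

(** The norm is the largest absolute value of an entry, and the entries of [proj_skew A] are 0 or,
    up to sign, entries of [A]; so the constant is kept. *)
Lemma lip_proj_skew (V : normedModType R) n (F : V -> 'M[R]_n.+1) :
  locally_lipschitz F -> locally_lipschitz (fun A => proj_skew (F A)).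
Proof.
move=> lF r; have [K K0 HF] := lF r; exists K => // A B Ar Br.
apply: le_trans (HF A B Ar Br); apply: mx_norm_le => // i j.
rewrite !mxE; case: ltngtP => _; last by rewrite subrr normr0.
  by have := mx_entry_le_norm (F A - F B) i j; rewrite !mxE.
by rewrite -opprD normrN; have := mx_entry_le_norm (F A - F B) j i; rewrite !mxE.
Qed.

Lemma lip_toda n (p : {poly R}) :
  locally_lipschitz (toda_field p : 'M[R]_n.+1 -> 'M[R]_n.+1).
Proof.
have lK := lip_proj_skew (@lip_horner_mx n p); have li := @lip_id 'M[R]_n.+1.
by apply: lipD; [exact: lip_mulmx|apply: lipN; exact: lip_mulmx].
Qed.

Lemma lip_linear_field Ny Nz (C : 'M[R]_Nz) :
  locally_lipschitz (linear_field C : 'cV[R]_(Ny + Nz) -> _).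
Proof.
have ld : locally_lipschitz (@dsubmx R Ny Nz 1).
  move=> r; exists 1 => // A B _ _; rewrite mul1r; apply: mx_norm_le => // i j.
  by have := mx_entry_le_norm (A - B) (rshift Ny i) j; rewrite !mxE.
have lC := lip_mulmx (lip_cst _ C) ld.
move=> r; have [K K0 HC] := lC r; exists K => // A B Ar Br.
apply: le_trans (HC A B Ar Br); apply: mx_norm_le => // i j.
rewrite /linear_field opp_col_mx add_col_mx; case: (split_ordP i) => k ->.
  by rewrite col_mxEu !mxE subrr normr0.
by rewrite col_mxEd mx_entry_le_norm.
Qed.

(** Gronwall is applied to the sum of squares of the entries of [c - c'], since the entrywise
    maximum norm need not be differentiable along the curve. *)
Lemma ode_unique m n (F : 'M[R]_(m, n) -> 'M[R]_(m, n)) (J : set R)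
    (c c' : R -> 'M[R]_(m, n)) (t0 t : R) :
  locally_lipschitz F -> is_interval J ->
  integral_curve F J c -> integral_curve F J c' -> J t0 -> J t ->
  c t0 = c' t0 -> c t = c' t.
Proof.
move=> lF iJ dc dc' J0 Jt E0.
pose a := Num.min t0 t; pose b := Num.max t0 t.
have ab : a <= b by rewrite /a /b ge_min !le_max lexx.
have sJ s : a <= s <= b -> J s.
  move=> sab; have [t0t|tt0] := leP t0 t.
    by apply: (iJ t0 t) => //; move: sab; rewrite /a /b min_l // max_r.
  by apply: (iJ t t0) => //; move: sab; rewrite /a /b min_r ?max_l // ltW.
have cN f : (forall s, J s -> derivable f s (1 : R)) ->
    exists r : R, forall s, a <= s <= b -> `|f s : 'M[R]_(m, n)| <= r.
  move=> df; have [|s _ Hs] := @EVT_max R (fun s => `|f s|) a b ab.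
    apply: continuous_in_subspaceT => s; rewrite inE /= in_itv /= => /sJ/df.
    move=> /derivable1_diffP/differentiable_continuous cf.
    by apply: continuous_comp => //; exact: norm_continuous.
  by exists `|f s| => s' sab; apply: Hs; rewrite in_itv.
have [r Hr] := cN c (fun s Js => @ex_derive _ _ _ _ _ _ _ (dc s Js)).
have [r' Hr'] := cN c' (fun s Js => @ex_derive _ _ _ _ _ _ _ (dc' s Js)).
have [K K0 HF] := lF (Num.max r r').
pose w s := c s - c' s; pose dw s := F (c s) - F (c' s).
have wE s i j : is_derive s (1 : R) w (dw s) ->
    is_derive s (1 : R) (fun x => w x i j) (dw s i j).
  by move=> /is_derive_mxP.
have dww s : J s -> is_derive s (1 : R) w (dw s).
  by move=> Js; apply: is_deriveB; [exact: dc|exact: dc'].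
pose u s := \sum_i \sum_j w s i j ^+ 2.
pose du s := \sum_i \sum_j (w s i j * dw s i j + w s i j * dw s i j).
have uE : u = \sum_(i < m) \sum_(j < n) ((fun s => w s i j) * (fun s => w s i j)).
  apply/funext => s; rewrite /u fct_sumE; apply: eq_bigr => i _.
  by rewrite fct_sumE; apply: eq_bigr => j _; rewrite expr2.
have dU s : a <= s <= b -> is_derive s (1 : R) u (du s).
  move=> /sJ/dww dws; rewrite uE /du.
  apply: is_derive_sum => i; apply: is_derive_sum => j.
  exact: is_deriveM (wE s i j dws) (wE s i j dws).
have u_ge0 s : 0 <= u s by apply: sumr_ge0 => i _; apply: sumr_ge0 => j _; exact: sqr_ge0.
have w2u s : `|w s| ^+ 2 <= u s.
  rewrite -(sqr_sqrtr (u_ge0 s)) ler_pXn2r ?nnegrE ?sqrtr_ge0 //.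
  apply: mx_norm_le => [|i j]; first exact: sqrtr_ge0.
  rewrite -sqrtr_sqr ler_sqrt //.
  rewrite /u (bigD1 i) //= (bigD1 j) //= -addrA lerDl addr_ge0 //.
    by apply: sumr_ge0 => k _; exact: sqr_ge0.
  by apply: sumr_ge0 => l _; apply: sumr_ge0 => k _; exact: sqr_ge0.
(* The factor 2 comes from the derivative of a square; each of the [m * n] terms [w i j * dw i j] is
   at most [K] times the squared norm of [w], hence at most [K * u]. *)
have bU s : a <= s <= b -> 0 <= u s /\ `|du s| <= (2 * K * (n%:R * m%:R)) * u s.
  move=> sab; split=> //.
  have dwK : `|dw s| <= K * `|w s|.
    by apply: HF; rewrite le_max ?Hr // Hr' // orbT.
  apply: (@le_trans _ _ (\sum_(i < m) \sum_(j < n) (2 * K * u s))).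
    apply: le_trans (ler_norm_sum _ _ _) _; apply: ler_sum => i _.
    apply: le_trans (ler_norm_sum _ _ _) _; apply: ler_sum => j _.
    have -> : w s i j * dw s i j + w s i j * dw s i j = 2 * (w s i j * dw s i j) by ring.
    rewrite normrM ger0_norm // -mulrA ler_wpM2l //.
    rewrite normrM; apply: (@le_trans _ _ (`|w s| * (K * `|w s|))).
      rewrite ler_pM ?mx_entry_le_norm //.
      exact: le_trans (mx_entry_le_norm _ _ _) dwK.
    by rewrite mulrCA ler_wpM2l // -expr2.
  rewrite !sumr_const !card_ord -mulrnA -[leLHS]mulr_natr natrM.
  by rewrite [leRHS]mulrAC.
have u0 : u t0 = 0.
  by rewrite /u big1 // => i _; rewrite big1 // => j _; rewrite /w E0 subrr mxE expr0n.
have ut : u t = 0.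
  have [] := gronwall0 ab dU bU _.
    by rewrite /a /b; case: (leP t0 t) => _; [left|right].
  by rewrite /a /b; case: (leP t0 t).
have := w2u t; rewrite ut => w0; apply/eqP; rewrite -subr_eq0 -normr_eq0.
by rewrite -sqrf_eq0 eq_le w0 sqr_ge0.
Qed.

End OdeUniqueness.

(** * Unipotent lower triangular matrices as a Euclidean space *)

Section LowerCoordinates.
Context {R : realType} {n : nat}.
Implicit Types (b : bool) (L : 'M[R]_n.+1).

(* For [b = false] there are no coordinates at all and [low] is the identity
   matrix; this describes the first unipotent factor on the orthogonal orbit. *)
Definition low_index b := {x : 'I_n.+1 * 'I_n.+1 | b && (x.2 < x.1)%N}.

Definition low_dim b := #|{: low_index b}|.

Definition low b (z : 'cV[R]_(low_dim b)) : 'M[R]_n.+1 :=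
  \matrix_(i, j) if (insub (i, j) : option (low_index b)) is Some x
                 then z (enum_rank x) 0 else (i == j)%:R.

Definition low_coord b L : 'cV[R]_(low_dim b) :=
  \col_k L (val (enum_val k)).1 (val (enum_val k)).2.

Lemma low_dim_false : low_dim false = 0%N.
Proof. by apply: eq_card0 => -[x]. Qed.

Lemma low_unil b (z : 'cV_(low_dim b)) : unil (low z).
Proof.
split=> [|i].
  apply/is_trig_mxP => i j ij; rewrite mxE insubN /=.
    by rewrite -val_eqE (ltn_eqF ij).
  by rewrite negb_and orbC -leqNgt ltnW.
by rewrite mxE insubN /= ?ltnn ?andbF // eqxx.
Qed.

Lemma low_false (z : 'cV_(low_dim false)) : low z = 1%:M.
Proof. by apply/matrixP => i j; rewrite !mxE insubN. Qed.

Lemma low_coordK b L : unil L -> b \/ L = 1%:M -> low (low_coord b L) = L.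
Proof.
move=> [/is_trig_mxP tL L1] bL; apply/matrixP => i j; rewrite mxE.
case: insubP => [x _ xE|]; first by rewrite mxE enum_rankK xE.
rewrite negb_and /= -leqNgt => H; case: bL H => [-> /= ij|->]; last by rewrite mxE.
have [{}ij|ji|/val_inj ->] := ltngtP i j; last by rewrite L1 eqxx.
  by rewrite tL // -val_eqE (ltn_eqF ij).
by move: ij; rewrite leqNgt ji.
Qed.

Lemma lowK b (z : 'cV_(low_dim b)) : low_coord b (low z) = z.
Proof.
by apply/colP => k; rewrite !mxE -surjective_pairing valK enum_valK.
Qed.

Lemma Ck_low (V : normedModType R) k (U : set V) b (z : V -> 'cV_(low_dim b)) :
  open U -> Ck_on k U z -> Ck_on k U (fun x => low (z x)).
Proof.
move=> oU /(Ck_mxP _ _ oU) Cz; apply/(Ck_mxP _ _ oU) => i j.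
under eq_fun do rewrite mxE; case: insubP => [x _ _|_]; first exact: Cz.
exact: Ck_cst.
Qed.

Lemma Ck_low_coord (V : normedModType R) k (U : set V) b (L : V -> 'M[R]_n.+1) :
  open U -> Ck_on k U L -> Ck_on k U (fun x => low_coord b (L x)).
Proof.
move=> oU /(Ck_mxP _ _ oU) CL; apply/(Ck_mxP _ _ oU) => i j.
by under eq_fun do rewrite mxE.
Qed.

End LowerCoordinates.
Arguments low_dim n b : clear implicits.

(** * Block columns, the QR orthogonal factor, nonroots near 0 *)

Section Auxiliary.
Context {R : realType}.

Lemma Ck_col_mx (V : normedModType R) k (U : set V) m1 m2 p
    (A : V -> 'M[R]_(m1, p)) (B : V -> 'M[R]_(m2, p)) : open U ->
  Ck_on k U A -> Ck_on k U B -> Ck_on k U (fun x => col_mx (A x) (B x)).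
Proof.
move=> oU /(Ck_mxP _ _ oU) CA /(Ck_mxP _ _ oU) CB; apply/(Ck_mxP _ _ oU) => i j.
case: (split_ordP i) => l ->.
  by under eq_fun do rewrite col_mxEu.
by under eq_fun do rewrite col_mxEd.
Qed.

Lemma Ck_usubmx k m1 m2 p (U : set 'M[R]_(m1 + m2, p)) : open U ->
  Ck_on k U (@usubmx R m1 m2 p).
Proof.
move=> oU; apply/(Ck_mxP _ _ oU) => i j; under eq_fun do rewrite mxE.
exact: Ck_coord.
Qed.

Lemma Ck_dsubmx k m1 m2 p (U : set 'M[R]_(m1 + m2, p)) : open U ->
  Ck_on k U (@dsubmx R m1 m2 p).
Proof.
move=> oU; apply/(Ck_mxP _ _ oU) => i j; under eq_fun do rewrite mxE.
exact: Ck_coord.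
Qed.

Lemma row_diag_mulmx m p (d : 'rV[R]_m) (A : 'M[R]_(m, p)) i :
  row i (diag_mx d *m A) = d 0 i *: row i A.
Proof. by apply/rowP => j; rewrite mul_diag_mx !mxE. Qed.

Lemma diag_mulcolE m (d : 'rV[R]_m) (f : 'I_m -> R) k :
  (diag_mx d *m \col_k f k) k 0 = d 0 k * f k.
Proof. by rewrite mul_diag_mx !mxE. Qed.

Lemma dconj1 m (d : 'rV[R]_m) : (forall i, d 0 i != 0) -> dconj d 1%:M = 1%:M.
Proof.
move=> d0; apply/matrixP => i j; rewrite !mxE.
by case: eqVneq => [<-|_]; rewrite ?mulr0 ?mul0r // mulr1 divff.
Qed.

(** Gram-Schmidt: the orthogonal factor of the QR factorization, used to turn a path of invertible
    matrices into one of orthogonal matrices. *)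
Definition qfactor m (X : 'M[R]_m) := X *m invmx (chol (X^T *m X)).

Lemma qfactor_orthogonal m (X : 'M[R]_m) : X \in unitmx -> (qfactor X)^T *m qfactor X = 1%:M.
Proof.
move=> uX; have [tV V0 VE] := chol_spec (posdef_gram uX).
by apply: gram_orthogonal VE; apply: upu_unit; split=> // i; rewrite gt_eqF.
Qed.

Lemma Ck_qfactor (V : normedModType R) k (U : set V) m (A : V -> 'M[R]_m) :
  open U -> (forall x, U x -> A x \in unitmx) -> Ck_on k U A ->
  Ck_on k U (fun x => qfactor (A x)).
Proof.
move=> oU uA CA; have pA x : U x -> posdef ((A x)^T *m A x).
  by move=> /uA/posdef_gram.
have CG := Ck_mulmx oU (Ck_tr oU CA) CA.
apply: (Ck_mulmx oU CA); apply: (Ck_invmx oU _ (Ck_chol oU pA CG)).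
move=> x /pA/chol_spec[tV V0 _].
by apply: upu_unit; split=> // i; rewrite gt_eqF.
Qed.

Lemma Ck_horner_mx (V : normedModType R) k (U : set V) n (A : V -> 'M[R]_n.+1) p :
  open U -> Ck_on k U A -> Ck_on k U (fun x => horner_mx (A x) p).
Proof.
move=> oU CA; elim/poly_ind: p => [|p c IH].
  by under eq_fun do rewrite rmorph0; exact: Ck_cst.
under eq_fun do rewrite rmorphD rmorphM /= horner_mx_X horner_mx_C.
by apply: CkD => //; [exact: Ck_mulmx|exact: Ck_cst].
Qed.

Lemma nbhs0_nonroot (p : {poly R}) (P : set R) : p != 0 -> nbhs (0 : R) P ->
  exists2 t, P t & p.[t] != 0.
Proof.
move=> p0 /nbhs_ballP[r /= r0 rP].
(* Starting the denominators at 2 keeps every point inside the open ball; [size p] distinct points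
   cannot all be roots of a nonzero [p]. *)
pose t k : R := r / k.+2%:R.
have tP k : P (t k).
  apply: rP; rewrite /ball /= sub0r normrN ger0_norm ?divr_ge0 ?ltW //.
  by rewrite ltr_pdivrMr ?ltr0n // ltr_pMr // ltr1n.
have [/allP H|/allPn[k _ tk]] := boolP (all (fun k => root p (t k)) (iota 0 (size p))).
  have rt : all (root p) (map t (iota 0 (size p))).
    by apply/allP => _ /mapP[k kp ->]; exact: H.
  have ut : uniq (map t (iota 0 (size p))).
    rewrite map_inj_uniq ?iota_uniq // => i j /(mulfI (lt0r_neq0 r0))/invr_inj.
    by move/eqP; rewrite eqr_nat => /eqP[].
  by have := max_poly_roots p0 rt ut; rewrite size_map size_iota ltnn.
by exists (t k).
Qed.

End Auxiliary.

(** * The two orbits, their charts, and the flow in them *)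

Section SpectralOrbit.
Context {R : realType} {n : nat}.
Variable D : 'M[R]_n.+1.
Hypotheses (D_diag : is_diag_mx D) (D_simple : simple_spectrum D).
Implicit Types (s : 'S_n.+1) (b : bool) (M X T L : 'M[R]_n.+1) (p : {poly R}).

Definition eigs s : 'rV[R]_n.+1 := \row_i D (s i) (s i).

(** Both orbits at once: [true] gives the GL orbit, [false] the orthogonal one. Symmetry of [M]
    stands in for orthogonality of the conjugating matrix, so [X] may be rescaled freely in either
    case. *)
Definition orb b : set 'M[R]_n.+1 := [set M |
  (exists2 X, X \in unitmx & X *m M = D *m X) /\ (b \/ M^T = M)].

Lemma D_diagE : D = diag_mx (\row_i D i i).
Proof.
apply/matrixP => i j; rewrite !mxE; case: eqVneq => [->|ij]; rewrite ?mulr1n //.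
by rewrite (is_diag_mxP D_diag).
Qed.

Lemma D_inj : injective (fun i => D i i).
Proof.
move=> i j Dij; apply/eqP; apply: contraT => ij; set a := D i i.
have cE : char_poly D = \prod_(k < n.+1) ('X - (D k k)%:P).
  exact/char_poly_trig/is_diag_mx_is_trig.
have r : root (char_poly D) a.
  by rewrite cE (bigD1 i) //= rootM root_XsubC eqxx.
have := D_simple _; move=> /(_ a); rewrite eigenvalue_root_char r => /(_ isT) m1.
have c0 : char_poly D != 0 by rewrite monic_neq0 // char_poly_monic.
suff : (2 <= mup a (char_poly D))%N by rewrite m1.
rewrite mup_geq // cE (bigD1 i) //= (bigD1 j) /=; last by rewrite eq_sym.
by rewrite -Dij -/a mulrA -expr2 dvdp_mulIl.
Qed.

Lemma eigs_inj s : injective (eigs s 0).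
Proof. by move=> i j; rewrite !mxE => /D_inj/perm_inj. Qed.

Lemma D_mulE m (A : 'M[R]_(n.+1, m)) i j : (D *m A) i j = D i i * A i j.
Proof. by rewrite {1}D_diagE mul_diag_mx !mxE. Qed.

Lemma row_perm_eigs s X M : X *m M = D *m X ->
  row_perm s X *m M = diag_mx (eigs s) *m row_perm s X.
Proof.
move=> XM; rewrite [in LHS]row_permE -mulmxA XM -row_permE; apply/matrixP => i j.
by rewrite mxE D_mulE mul_diag_mx !mxE.
Qed.

Lemma orb_eigs s b M : orb b M ->
  exists2 X, X \in unitmx & X *m M = diag_mx (eigs s) *m X.
Proof.
move=> [[X uX XM] _]; exists (row_perm s X); last exact: row_perm_eigs.
by rewrite row_permE unitmx_mul unitmx_perm.
Qed.

Lemma eigs_orb s b X M : X \in unitmx -> X *m M = diag_mx (eigs s) *m X ->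
  b \/ M^T = M -> orb b M.
Proof.
move=> uX XM bM; split=> //; exists (row_perm s^-1 X).
  by rewrite row_permE unitmx_mul unitmx_perm.
rewrite [in LHS]row_permE -mulmxA XM -row_permE; apply/matrixP => i j.
by rewrite D_mulE mul_diag_mx !mxE permKV.
Qed.

Lemma orb_true : orb true = GL_orbit D.
Proof.
apply/seteqP; split=> M.
  move=> [[X uX XM] _]; exists X => //.
  by rewrite -mulmxA -XM mulKmx.
move=> [X uX ->]; split; last by left.
by exists X => //; rewrite !mulmxA mulmxV // mul1mx.
Qed.

(** Eigenvectors of a symmetric matrix for distinct eigenvalues are orthogonal; here, [X X^T]
    commutes with [diag_mx e]. *)
Lemma sym_eigen_gram (e : 'rV[R]_n.+1) X M : injective (e 0) -> X *m M = diag_mx e *m X ->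
  M^T = M -> is_diag_mx (X *m X^T).
Proof.
move=> ei XM MT; apply: (commute_diag ei).
have E : X^T *m diag_mx e = M *m X^T.
  by rewrite -[in RHS]MT -trmx_mul XM trmx_mul tr_diag_mx.
by rewrite -mulmxA E !mulmxA XM.
Qed.

Lemma orb_false : orb false = orthogonal_orbit D.
Proof.
have DT : D^T = D by rewrite D_diagE tr_diag_mx.
apply/seteqP; split=> M; last first.
  move=> [Q QQ ->]; split; last first.
    by right; rewrite !trmx_mul trmxK DT mulmxA.
  have uQ : Q \in unitmx by have [] := mulmx1_unit QQ.
  exists Q => //; rewrite !mulmxA.
  by rewrite (mulmx1C QQ) mul1mx.
move=> [[X uX XM] [//|MT]].
have Di : injective ((\row_i D i i) 0) by move=> i j; rewrite !mxE => /D_inj.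
have XM' := XM; rewrite D_diagE in XM'.
have /is_diag_mxP dS := sym_eigen_gram Di XM' MT.
have S0 i : 0 < (X *m X^T) i i.
  have [_ qS] := posdef_gramC uX.
  have := posdef_diag_gt0 i (posdef_gramC uX) (unitmx1 _ _).
  by rewrite trmx1 mul1mx mulmx1.
pose g : 'rV[R]_n.+1 := \row_i (Num.sqrt ((X *m X^T) i i))^-1.
pose Q := diag_mx g *m X.
have QQ : Q *m Q^T = 1%:M.
  rewrite trmx_mul tr_diag_mx mulmxA -(mulmxA (diag_mx g)).
  apply/matrixP => i j; rewrite mul_mx_diag mxE mul_diag_mx [X in X * _]mxE [RHS]mxE.
  case: eqVneq => [<-|ij]; last by rewrite dS // mulr0 mul0r.
  rewrite !mxE -/((X *m X^T) i i); have -> : \sum_j X i j * X^T j i = (X *m X^T) i i.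
    by rewrite mxE.
  rewrite mulrAC -expr2 exprVn sqr_sqrtr ?ltW // mulVf // gt_eqF //.
exists Q; first exact: mulmx1C.
have QM : Q *m M = D *m Q.
  by rewrite -mulmxA XM !mulmxA [in LHS]D_diagE diag_mxC -D_diagE.
by rewrite -mulmxA -QM mulmxA (mulmx1C QQ) mul1mx.
Qed.

Section Chart.
Variables (b : bool) (s : 'S_n.+1).
Let e := eigs s.
Let N := (low_dim n b + low_dim n true)%N.

Definition psi (w : 'cV[R]_N) : 'M[R]_n.+1 :=
  chart_inv e (low (usubmx w)) (low (dsubmx w)).

Definition coords T L : 'cV[R]_N := col_mx (low_coord b T) (low_coord true L).

(** The domain is the image of the parametrization and the chart its inverse, with value 0
    elsewhere; the LU description is recovered by [chart_dom_mem] and [psi_eigen]. *)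
Definition chart_dom : set 'M[R]_n.+1 := range psi.

Definition chart M : 'cV[R]_N := xget 0 [set w | psi w = M].

Lemma psi_inj : injective psi.
Proof.
move=> w w' /(chart_inv_inj (@eigs_inj s) (low_unil _) (low_unil _) (low_unil _)
  (low_unil _))[E1 E2].
rewrite -[w]vsubmxK -[w']vsubmxK; congr col_mx.
  by rewrite -[LHS]lowK E1 lowK.
by rewrite -[LHS]lowK E2 lowK.
Qed.

Lemma psiK : cancel psi chart.
Proof.
move=> w; apply: psi_inj.
exact: (@xgetPex _ 0 [set v | psi v = psi w] (ex_intro _ w erefl)).
Qed.

Lemma chartK M : chart_dom M -> psi (chart M) = M.
Proof. by move=> [w _ <-]; rewrite psiK. Qed.

Lemma psi_eigen w : exists X, [/\ X \in unitmx, piv X != 0 &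
  X *m psi w = diag_mx e *m X].
Proof.
exists (frame (low (usubmx w)) (low (dsubmx w))); split.
- by apply: frame_unit; exact: low_unil.
- by apply: frame_piv; exact: low_unil.
- by apply: frame_eigen; exact: low_unil.
Qed.

Lemma psi_orb w : orb b (psi w).
Proof.
have [X [uX _ XM]] := psi_eigen w; apply: eigs_orb uX XM _.
case: (boolP b) => [|/negbTE bF]; [by left|right].
rewrite /psi; have -> : low (usubmx w) = 1%:M.
  by move: (usubmx w); rewrite bF; exact: low_false.
have [] := frame_spec (unil1 n.+1) (low_unil (dsubmx w)).
rewrite /chart_inv mul1mx; set Q := frame _ _ => QQ _.
have uQ : Q \in unitmx by have [] := mulmx1_unit QQ.
have -> : invmx Q = Q^T by rewrite -[RHS](mulmxK uQ) QQ mul1mx.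
clearbody Q.
by rewrite !trmx_mul trmxK tr_diag_mx mulmxA.
Qed.

Lemma nT_diag X : piv X != 0 -> is_diag_mx (X *m X^T) -> nT X = 1%:M.
Proof.
move=> pX dS; have pS := posdef_gramC (piv_unit pX).
have S0 i : (X *m X^T) i i != 0.
  have := posdef_diag_gt0 i pS (unitmx1 _ _).
  by rewrite trmx1 mul1mx mulmx1 => /lt0r_neq0.
have uS : upu (X *m X^T).
  by split=> //; rewrite (proj1 pS); exact: is_diag_mx_is_trig.
rewrite /nT -[X *m X^T]mul1mx luL_eq //; last exact: unil1.
by rewrite invmx1 dconj1 // => i; exact: nscale_neq0.
Qed.

Lemma psi_norm X M : piv X != 0 -> X *m M = diag_mx e *m X -> b \/ M^T = M ->
  psi (coords (nT X) (nL X)) = M.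
Proof.
move=> pX XM bM; rewrite /psi col_mxKu col_mxKd !low_coordK; last 2 first.
- exact: nT_unil.
- case: bM => [->|MT]; [by left|right].
  by apply: nT_diag => //; exact: sym_eigen_gram (@eigs_inj s) XM MT.
- exact: chart_inv_norm.
- exact: nL_unil.
- by left.
Qed.

Lemma chart_dom_mem X M : piv X != 0 -> X *m M = diag_mx e *m X ->
  b \/ M^T = M -> chart_dom M.
Proof. by move=> pX XM bM; exists (coords (nT X) (nL X)) => //; exact: psi_norm. Qed.

(** A Lagrange interpolation polynomial up to a factor: at a matrix of the orbit it is a nonzero
    multiple of the spectral projector for [e 0 i], yet it makes sense at every matrix. *)
Definition cofactor_poly i : {poly R} := \prod_(j | j != i) ('X - (e 0 j)%:P).

(* Row [i] of [eigvec X0 M] is row [i] of [X0] times the product over [j != i]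
   of [M - e_j], which maps every row vector to a left eigenvector for [e_i]. *)
Definition eigvec X0 M : 'M[R]_n.+1 :=
  \matrix_(i, j) (X0 *m horner_mx M (cofactor_poly i)) i j.

Lemma horner_mx_eigen X M p : X *m M = diag_mx e *m X ->
  X *m horner_mx M p = diag_mx (map_mx (horner p) e) *m X.
Proof.
move=> XM; rewrite -horner_mx_diag; elim/poly_ind: p => [|p c IH].
  by rewrite !rmorph0 mulmx0 mul0mx.
rewrite !rmorphD !rmorphM /= !horner_mx_X !horner_mx_C mulmxDr mulmxDl.
by rewrite mulmxA IH -mulmxA XM mulmxA scalar_mxC.
Qed.

Lemma eigvec_eigen b' X0 M : orb b' M ->
  eigvec X0 M *m M = diag_mx e *m eigvec X0 M.
Proof.
move=> /(orb_eigs s)[X uX XM]; apply/row_matrixP => i.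
have rE : row i (eigvec X0 M) = row i X0 *m horner_mx M (cofactor_poly i).
  by rewrite -row_mul; apply/rowP => j; rewrite !mxE.
rewrite row_mul rE row_diag_mulmx rE -mulmxA.
suff : horner_mx M (cofactor_poly i) *m horner_mx M 'X =
    e 0 i *: horner_mx M (cofactor_poly i).
  by rewrite horner_mx_X => ->; rewrite -scalemxAr.
apply/eqP; rewrite -subr_eq0 -mul_mx_scalar -(horner_mx_C M) -mulmxBr -rmorphB.
rewrite -[_ *m _]/(_ * _) -rmorphM /=; apply/eqP/(can_inj (mulKmx uX)).
rewrite mulmx0 (horner_mx_eigen _ XM); apply/matrixP => k j.
rewrite mul_diag_mx [LHS]mxE [RHS]mxE [X in X * _]mxE hornerM.
rewrite hornerXsubC /cofactor_poly horner_prod.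
have [->|ki] := eqVneq k i; first by rewrite subrr mulr0 mul0r.
by rewrite (bigD1 k) //= hornerXsubC subrr !mul0r.
Qed.

(** When [X0] already diagonalizes [M], its rows are only multiplied by the nonzero numbers
    [(cofactor_poly i).[e 0 i]], and this keeps the LU factorization. *)
Lemma eigvec_base X0 M : piv X0 != 0 -> X0 *m M = diag_mx e *m X0 ->
  piv (eigvec X0 M) != 0.
Proof.
move=> pX XM; pose c : 'rV[R]_n.+1 := \row_i (cofactor_poly i).[e 0 i].
have -> : eigvec X0 M = diag_mx c *m X0.
  apply/matrixP => i j; rewrite mxE (horner_mx_eigen _ XM) !mul_diag_mx !mxE.
  by [].
have c0 i : c 0 i != 0.
  rewrite mxE horner_prod; apply/prodf_neq0 => j ji.
  by rewrite hornerXsubC subr_eq0; apply: contra ji => /eqP/(@eigs_inj s) ->.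
have [U uU ->] := lu_exists pX; rewrite mulmxA.
have [tL L1] := luL_unil X0.
apply: piv_lu => // [|i]; first by rewrite trig_mulmx ?diag_mx_is_trig.
by rewrite trig_mulmx_diag ?diag_mx_is_trig // L1 mulr1 diag_mxii.
Qed.

Lemma Ck_eigvec k X0 : Ck_on k setT (eigvec X0).
Proof.
apply/(Ck_mxP _ _ openT) => i j; under eq_fun do rewrite mxE.
have Cid : Ck_on k setT (fun M : 'M[R]_n.+1 => M).
  by apply/(Ck_mxP _ _ openT) => i' j'; exact: (Ck_coord _ _ _ openT).
have CX := Ck_mulmx openT (Ck_cst k setT X0)
  (Ck_horner_mx (cofactor_poly i) openT Cid).
by have /(Ck_mxP _ _ openT)/(_ i j) := CX.
Qed.

(** An open condition on all matrices that serves twice: these sets together cut the chart domain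
    out of the orbit, and on each of them the chart has a smooth extension. *)
Definition regular X0 : set 'M[R]_n.+1 := [set M | piv (eigvec X0 M) != 0].

Lemma open_regular X0 : open (regular X0).
Proof.
have cp : continuous (fun M => piv (eigvec X0 M)).
  by move=> M; apply: (Ck_piv openT (Ck_eigvec 0 X0)).
have -> : regular X0 = (fun M => piv (eigvec X0 M)) @^-1` [set x | x != 0] by [].
by apply: open_comp => //; exact: open_neq.
Qed.

Lemma chart_dom_regular M : orb b M -> (exists X0, regular X0 M) -> chart_dom M.
Proof.
move=> oM [X0 rM]; apply: (chart_dom_mem rM); last by case: oM.
exact: eigvec_eigen oM.
Qed.

Lemma regular_chart_dom M : chart_dom M -> exists X0, regular X0 M.
Proof.
by move=> [w _ <-]; have [X [uX pX XM]] := psi_eigen w; exists X; exact: eigvec_base.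
Qed.

Lemma open_in_chart_dom : open_in (orb b) chart_dom.
Proof.
exists (\bigcup_X0 regular X0); first by apply: bigcup_open => X0 _; exact: open_regular.
apply/seteqP; split=> [M cM|M [oM [X0 _ rM]]].
  split; first by case: cM => w _ <-; exact: psi_orb.
  by have [X0 rM] := regular_chart_dom cM; exists X0.
by apply: chart_dom_regular => //; exists X0.
Qed.

Lemma smooth_chart : smooth_on chart_dom chart.
Proof.
move=> M cM; have [X0 rM] := regular_chart_dom cM; have oW := @open_regular X0.
exists (regular X0), (fun M => coords (nT (eigvec X0 M)) (nL (eigvec X0 M))).
split=> // [k|M' rM' cM'].
  have CX : Ck_on k (regular X0) (eigvec X0).
    exact: Ck_sub (@subsetT _ _) (Ck_eigvec k X0).
  apply: Ck_col_mx => //; apply: Ck_low_coord => //.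
    exact: (Ck_nT oW).
  exact: (Ck_nL oW).
have oM' : orb b M' by case: cM' => w _ <-; exact: psi_orb.
apply: psi_inj; rewrite chartK //; apply/esym/psi_norm => //; last by case: oM'.
exact: eigvec_eigen oM'.
Qed.

Lemma Ck_psi k : Ck_on k setT psi.
Proof.
have Cu : Ck_on k setT (fun w : 'cV[R]_N => low (usubmx w)).
  exact: (Ck_low openT (Ck_usubmx k openT)).
have Cd : Ck_on k setT (fun w : 'cV[R]_N => low (dsubmx w)).
  exact: (Ck_low openT (Ck_dsubmx k openT)).
apply: (Ck_chart_inv openT e _ _ Cu Cd) => w _; exact: low_unil.
Qed.

Lemma diffeo_chart : diffeomorphism chart_dom setT chart.
Proof.
split; first split=> //.
- by move=> M M' /set_mem cM /set_mem cM' E; rewrite -(chartK cM) -(chartK cM') E.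
- by move=> w _; exists (psi w); [exists w|exact: psiK].
- exact: smooth_chart.
- exists psi; last exact: chartK.
  move=> w _; exists setT, psi; split=> //; first exact: openT.
  by move=> k; exact: Ck_psi.
Qed.

(** With [X = L W] the eigenvalue equation becomes [W E W^-1 = L^-1 diag(e) L]. The left side is
    upper triangular with the diagonal of [E], the right side lower triangular with diagonal [e]. *)
Lemma diag_chart_dom M : chart_dom M -> is_diag_mx M -> M = diag_mx e.
Proof.
move=> [w _ <-]; set E := psi w => dE.
have := frame_eigen e (low_unil (usubmx w)) (low_unil (dsubmx w)).
rewrite -/(psi w) -/E; have uL := low_unil (dsubmx w).
have [_ [W [uW _ ->]]] := frame_spec (low_unil (usubmx w)) uL.
set L := low _ in uL *; have vL := unil_unit uL; have vW := upu_unit uW.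
have [[tL L1] [tW _]] := (uL, uW); have [tW' _] := upuV uW.
have [tL' L1'] := unilV uL => LE.
have tE : is_trig_mx E^T.
  apply/is_trig_mxP => i j ij; rewrite mxE (is_diag_mxP dE) //.
  by rewrite gt_eqF.
clearbody E.
have E1 : W *m E *m invmx W = invmx L *m diag_mx e *m L.
  apply: (can_inj (mulmxK vW)); rewrite mulmxKV //.
  by apply: (can_inj (mulKmx vL)); rewrite !mulmxA LE mulmxV // mul1mx -!mulmxA.
apply/matrixP => i j; rewrite [RHS]mxE; case: eqVneq => [<-|ij]; last first.
  by rewrite mulr0n (is_diag_mxP dE).
rewrite mulr1n; have /matrixP/(_ i i) := E1.
rewrite (upu_diag _ (upper_mulmx tW tE) tW') (upu_diag _ tW tE) upuV_diag //.
rewrite mulrAC divff ?mul1r; last by case: uW.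
rewrite (trig_mulmx_diag _ (trig_mulmx tL' (diag_mx_is_trig e)) tL) L1 mulr1.
by rewrite (trig_mulmx_diag _ tL' (diag_mx_is_trig e)) L1' mul1r diag_mxii.
Qed.

Definition rates p : 'rV[R]_(low_dim n true) :=
  \row_k (p.[e 0 (val (enum_val k)).1] - p.[e 0 (val (enum_val k)).2]).

Definition linear_flow p (t : R) (w : 'cV[R]_N) : 'cV[R]_N :=
  col_mx (usubmx w) (\col_k (expR (t * rates p 0 k) * dsubmx w k 0)).

Lemma linear_flowD p t t' w : linear_flow p t (linear_flow p t' w) = linear_flow p (t + t') w.
Proof.
rewrite /linear_flow col_mxKu col_mxKd; congr col_mx.
by apply/colP => k; rewrite !mxE mulrA -expRD mulrDl.
Qed.

Lemma linear_flow0 p w : linear_flow p 0 w = w.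
Proof.
rewrite -[RHS]vsubmxK; congr col_mx; apply/colP => k.
by rewrite mxE mul0r expR0 mul1r.
Qed.

Lemma is_derive_linear_flow p t w : is_derive t (1 : R)
  (fun t => linear_flow p t w) (linear_field (diag_mx (rates p)) (linear_flow p t w)).
Proof.
apply/is_derive_mxP => i j; rewrite ord1 /linear_field col_mxKd.
case: (split_ordP i) => k ->.
  have -> : (fun x => linear_flow p x w (lshift _ k) 0) = cst (usubmx w k 0).
    by apply/funext => x; rewrite col_mxEu.
  by rewrite col_mxEu [X in is_derive _ _ _ X]mxE; exact: is_derive_cst.
have -> : (fun x => linear_flow p x w (rshift _ k) 0) =
    dsubmx w k 0 *: (fun x => expR (x * rates p 0 k)).
  by apply/funext => x; rewrite col_mxEd mxE; exact: mulrC.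
apply: is_derive_eq (is_deriveZ _ (is_derive_expZ _ _)) _.
rewrite col_mxEd diag_mulcolE.
suff : dsubmx w k 0 * (rates p 0 k * expR (t * rates p 0 k)) =
  rates p 0 k * (expR (t * rates p 0 k) * dsubmx w k 0) by [].
by ring.
Qed.

Lemma low_linear_flow p t w :
  low (dsubmx (linear_flow p t w)) = zflow e p (low (dsubmx w)) t.
Proof.
rewrite col_mxKd; apply/matrixP => i j; rewrite !mxE.
case: insubP => [x _ xE|_]; first by rewrite !mxE enum_rankK xE.
by case: eqVneq => [->|_]; rewrite ?subrr ?mulr0 // expR0 mulr1.
Qed.

Lemma is_derive_toda_flow p t w : is_derive t (1 : R)
  (fun t => psi (linear_flow p t w)) (toda_field p (psi (linear_flow p t w))).
Proof.
have E : (fun t => psi (linear_flow p t w)) =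
    (fun t => chart_inv e (low (usubmx w)) (zflow e p (low (dsubmx w)) t)).
  by apply/funext => x; rewrite /psi low_linear_flow col_mxKu.
rewrite E; have -> : psi (linear_flow p t w) = _ := congr1 (@^~ t) E.
by apply: toda_chart_inv; exact: low_unil.
Qed.

(** The comparison curve is defined for all times and never leaves the image of [psi], so invariance
    of the domain comes with the formula. The inner flow by [- t0] moves the data from time [t0]
    back to time 0. *)
Lemma toda_flow_unique p J (c : R -> 'M[R]_n.+1) t0 t : is_interval J ->
  integral_curve (toda_field p) J c -> J t0 -> J t -> chart_dom (c t0) ->
  c t = psi (linear_flow p t (linear_flow p (- t0) (chart (c t0)))).
Proof.
move=> iJ dc J0 Jt c0.
set w := linear_flow p (- t0) _.
apply: (@ode_unique R _ _ _ J c (fun x => psi (linear_flow p x w)) t0 t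
  (@lip_toda R n p) iJ dc _ J0 Jt).
  by move=> x _; exact: is_derive_toda_flow.
by rewrite linear_flowD subrr linear_flow0 chartK.
Qed.

Lemma linear_flow_unique p J (c : R -> 'cV[R]_N) t0 t : is_interval J ->
  integral_curve (linear_field (diag_mx (rates p))) J c -> J t0 -> J t ->
  c t = linear_flow p t (linear_flow p (- t0) (c t0)).
Proof.
move=> iJ dc J0 Jt.
set w := linear_flow p (- t0) _.
apply: (@ode_unique R _ _ _ J c (fun x => linear_flow p x w) t0 t
  (@lip_linear_field R _ _ _) iJ dc _ J0 Jt).
  by move=> x _; exact: is_derive_linear_flow.
by rewrite linear_flowD subrr linear_flow0.
Qed.

(** No chain rule for the chart, which is smooth only along the orbit: in both directions uniqueness
    identifies the given curve on [J] with an explicit one whose image under [chart] or [psi] has a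
    known derivative. *)
Lemma toda_linearized p J (c : R -> 'M[R]_n.+1) : open_interval J ->
  (forall t, J t -> chart_dom (c t)) ->
  integral_curve (toda_field p) J c <->
  integral_curve (linear_field (diag_mx (rates p))) J (fun t => chart (c t)).
Proof.
move=> [oJ iJ] cJ.
have near_J (V : normedModType R) (f g : R -> V) t : J t ->
    (forall x, J x -> f x = g x) -> \near t, f t = g t.
  by move=> Jt fg; apply: filterS (open_nbhs_nbhs (conj oJ Jt)) => x; exact: fg.
split=> dc t Jt.
  set w := linear_flow p (- t) (chart (c t)).
  have E x : J x -> linear_flow p x w = chart (c x).
    by move=> Jx; rewrite (toda_flow_unique iJ dc Jt Jx (cJ t Jt)) psiK.
  apply: near_eq_is_derive (near_J _ _ _ t Jt E) _.
  by rewrite -E //; exact: is_derive_linear_flow.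
set w := linear_flow p (- t) (chart (c t)).
have E x : J x -> psi (linear_flow p x w) = c x.
  move=> Jx; have /= <- := linear_flow_unique iJ dc Jt Jx.
  by rewrite chartK //; exact: cJ.
apply: near_eq_is_derive (near_J _ _ _ t Jt E) _.
by rewrite -E //; exact: is_derive_toda_flow.
Qed.

(** Conjugate [M] by the orthogonal factor [Q t] of [Y t = (1 - t) + t X^-1]; this stays in the
    orbit, symmetric or not, and tends to [M] at 0. The eigenvector matrix becomes [X Q t], which
    differs from [X Y t] by an invertible upper factor on the right, so only [piv (X Y t)] matters.
    It is a polynomial in [t], nonzero because [X Y 1 = 1], hence nonzero at arbitrarily small
    [t]. *)
Lemma dense_chart_dom : dense_in (orb b) chart_dom.
Proof.
split=> [M [w _ <-]|M oM]; first exact: psi_orb.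
have [X uX XM] := orb_eigs s oM.
pose Y (t : R) := (1 - t)%:M + t *: invmx X.
pose Pl := piv ((1 - 'X) *: map_mx polyC X + 'X%:M).
have XY t : Pl.[t] = piv (X *m Y t).
  rewrite -[LHS]/(horner_eval t Pl) -piv_map; congr piv; apply/matrixP => i j.
  rewrite mulmxDr mul_mx_scalar -scalemxAr mulmxV // !mxE /horner_eval.
  rewrite /= /horner_eval.
  by rewrite hornerD hornerM hornerMn hornerX hornerC !hornerE mulr_natr.
have Pl0 : Pl != 0.
  apply/eqP => P0; have := XY 1; rewrite P0 horner0 /Y subrr.
  rewrite scale1r -scalemx1 scale0r add0r mulmxV // => /esym/eqP; apply/negP.
  rewrite -[1%:M]mulmx1; apply: piv_lu => [|i|]; first exact: scalar_mx_is_trig.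
    by rewrite mxE eqxx oner_neq0.
  by split=> [|i]; rewrite ?trmx1 ?scalar_mx_is_trig // mxE eqxx oner_neq0.
have CY k U : open U -> Ck_on k U Y.
  move=> oU; apply/(Ck_mxP _ _ oU) => i j; under eq_fun do rewrite !mxE.
  have Ct : Ck_on k U (fun t : R => t).
    by apply: (@Ck_linear R _ _ k U idfun) => x; exact: cvg_id.
  apply: CkD => //; last by apply: CkM => //; exact: Ck_cst.
  case: eqVneq => _; last by under eq_fun do rewrite mulr0n; exact: Ck_cst.
  under eq_fun do rewrite mulr1n.
  by apply: CkD => //; [exact: Ck_cst|exact: CkN].
pose U0 : set R := [set t | Y t \in unitmx].
have oU0 : open U0.
  have cd : continuous (fun t => \det (Y t)).
    by move=> t; apply: (Ck_det openT (CY 0%N setT openT)).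
  have -> : U0 = (fun t => \det (Y t)) @^-1` [set x | x != 0].
    by apply/seteqP; split=> t; rewrite /U0 /= unitmxE unitfE.
  by apply: open_comp => //; exact: open_neq.
have Y0 : Y 0 = 1%:M by rewrite /Y subr0 scale0r addr0.
have U00 : U0 0 by rewrite /U0 /= Y0 unitmx1.
pose Mt t := (qfactor (Y t))^T *m M *m qfactor (Y t).
have CQ : Ck_on 0 U0 (fun t => qfactor (Y t)).
  exact: (Ck_qfactor oU0 (fun t uY => uY) (CY 0%N U0 oU0)).
have CM := Ck_mulmx oU0 (Ck_mulmx oU0 (Ck_tr oU0 CQ) (Ck_cst 0 U0 M)) CQ.
have cM : {for 0, continuous Mt} by exact: (CM 0 U00).
have M0 : Mt 0 = M.
  have q1 : qfactor (1%:M : 'M[R]_n.+1) = 1%:M.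
    rewrite /qfactor mul1mx chol_eq ?invmx1 ?trmx1 ?scalar_mx_is_trig // => i.
    by rewrite mxE eqxx ltr01.
  by rewrite /Mt Y0 q1 trmx1 mul1mx mulmx1.
move=> B; rewrite -M0 => /cM nB0.
have nB : nbhs (0 : R) (Mt @^-1` B) by exact: nB0.
have := nbhs0_nonroot Pl0 (filterI nB (open_nbhs_nbhs (conj oU0 U00))).
move=> [t [/= Bt uY] Pt]; exists (Mt t); split=> //.
have QQ := qfactor_orthogonal uY.
apply: (@chart_dom_mem (X *m qfactor (Y t))).
- have [tV V0 _] := chol_spec (posdef_gram uY).
  have uV : upu (chol ((Y t)^T *m Y t)) by split=> // i; rewrite gt_eqF.
  rewrite /qfactor mulmxA; move: Pt; rewrite XY => /lu_exists[U uU ->].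
  rewrite -mulmxA; have [tL L1] := luL_unil (X *m Y t).
  by apply: piv_lu (upuM uU (upuV uV)) => // i; rewrite L1 oner_neq0.
- rewrite /Mt; move: (qfactor (Y t)) QQ => q QQ.
  by rewrite !mulmxA -(mulmxA X) (mulmx1C QQ) mulmx1 XM.
- case: oM => _ [->|MT]; [by left|right].
  by rewrite /Mt; move: (qfactor (Y t)) => q; rewrite !trmx_mul trmxK MT mulmxA.
Qed.

End Chart.

(** Gaussian elimination with pivoting: some row permutation of [X] has an LU factorization, and
    permuting the rows of an eigenvector matrix only reorders the eigenvalues. *)
Lemma chart_cover b M : orb b M -> exists s, chart_dom b s M.
Proof.
move=> oM; have [[X uX XM] bM] := oM.
have := cormen_lup_perm X; have := cormen_lup_correct X.
have := cormen_lup_lower X; have := cormen_lup_upper X.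
case: (cormen_lup X) => [[P L] U] /= Uup Llow PX /is_perm_mxP[s Ps].
exists s; apply: (@chart_dom_mem _ _ (row_perm s X)) => //; last exact: row_perm_eigs.
have tL : is_trig_mx L.
  by apply/is_trig_mxP => i j ij; rewrite Llow ?(ltnW ij) // -val_eqE (ltn_eqF ij).
have L1 i : L i i = 1 by rewrite Llow // eqxx.
have uLU : L *m U \in unitmx.
  by rewrite -[L *m U]/(L * U) -PX Ps unitmx_mul unitmx_perm.
have tU : is_trig_mx U^T by apply/is_trig_mxP => i j ij; rewrite mxE Uup.
have -> : row_perm s X = L *m U by rewrite row_permE -Ps; exact: PX.
apply: piv_lu => // [i|]; first by rewrite L1 oner_neq0.
split=> // i; move: uLU; rewrite unitmx_mul => /andP[_].
by rewrite -unitmx_tr trig_unitmx // => /forallP/(_ i); rewrite mxE.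
Qed.

Lemma chart_diag_unique b E : orb b E -> is_diag_mx E ->
  exists! s, chart_dom b s E.
Proof.
move=> oE dE; have [s cE] := chart_cover oE; exists s; split=> // s' cE'.
apply/permP => i; apply: D_inj.
have := diag_chart_dom cE' dE; rewrite {1}(diag_chart_dom cE dE).
by move=> /matrixP/(_ i i); rewrite !diag_mxii !mxE.
Qed.

End SpectralOrbit.

Theorem theorem1 (R : realType) (n : nat) (D : 'M[R]_n.+1)
    (O : set 'M[R]_n.+1)
    (D_diag : is_diag_mx D) (D_simple : simple_spectrum D)
    (O_orbit : O = orthogonal_orbit D \/ O = GL_orbit D) :
  exists (Ny Nz : nat)
         (U : 'S_n.+1 -> set 'M[R]_n.+1)
         (phi : 'S_n.+1 -> 'M[R]_n.+1 -> 'cV[R]_(Ny + Nz)),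
    [/\ (* dim O = N = Ny + Nz, and the charts form an atlas *)
        submanifold_of_dim (Ny + Nz) O /\ atlas O U phi,
        (* part 1 *)
        [/\ forall pi, open_in O (U pi) /\ dense_in O (U pi),
            forall E, O E -> is_diag_mx E -> exists! pi, U pi E
          & forall pi, diffeomorphism (U pi) [set: 'cV[R]_(Ny + Nz)] (phi pi)],
        (* part 2: invariance of the chart domains *)
        forall pi (p : {poly R}) (J : set R) (c : R -> 'M[R]_n.+1),
          open_interval J -> J 0 ->
          integral_curve (toda_field p) J c -> U pi (c 0) ->
          forall t, J t -> U pi (c t),
        (* part 2: the flow in the charts *)
        forall pi (p : {poly R}), exists2 C : 'M[R]_Nz, is_diag_mx C &
          forall (J : set R) (c : R -> 'M[R]_n.+1),
            open_interval J -> (forall t, J t -> U pi (c t)) ->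
            (integral_curve (toda_field p) J c <->
             integral_curve (linear_field C) J (fun t => phi pi (c t)))
      & O = orthogonal_orbit D -> Ny = 0%N].
Proof.
have [b [Ob bO]] : exists b, O = orb D b /\ (O = orthogonal_orbit D -> b = false).
  (* The split is on equality with the orthogonal orbit, not on [O_orbit]: for 1 by 1 matrices the
     orbits coincide, and the last clause must hold whenever [O] is the orthogonal one. *)
  have [OO|nO] := pselect (O = orthogonal_orbit D).
    by exists false; rewrite orb_false.
  by exists true; rewrite orb_true //; split=> //; case: O_orbit.
exists (low_dim n b), (low_dim n true), (chart_dom D b), (chart D b).
have diffeo s := diffeo_chart D_diag D_simple b s.
have charts s : exists2 T : set 'cV[R]_(low_dim n b + low_dim n true), open T &
    diffeomorphism (chart_dom D b s) T (chart D b s).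
  by exists setT; [exact: openT|exact: diffeo].
have domO s M : chart_dom D b s M -> O M.
  by rewrite Ob => -[w _ <-]; exact: psi_orb.
have oin s : open_in O (chart_dom D b s).
  by rewrite Ob; exact: open_in_chart_dom.
have cover M : O M -> exists s, chart_dom D b s M.
  by rewrite Ob; exact: chart_cover.
split.
- split.
    move=> M /cover[s cM]; have [T oT dT] := charts s.
    by exists (chart_dom D b s), T, (chart D b s).
  split=> [|s]; last by split.
  apply/seteqP; split=> [M [s _ /domO]//|M /cover[s cM]].
  by exists s.
- split=> // [s|E OE dE].
    by split=> //; rewrite Ob; exact: dense_chart_dom.
  by apply: chart_diag_unique => //; rewrite -Ob.
- move=> s p J c [oJ iJ] J0 dc c0 t Jt.
  rewrite (toda_flow_unique D_diag D_simple iJ dc J0 Jt c0).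
  by eexists.
- move=> s p; exists (diag_mx (rates D s p)); first exact: diag_mx_is_diag.
  by move=> J c oJ cJ; exact: toda_linearized.
- by move=> /bO ->; exact: low_dim_false.
Qed.
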